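(* Let $(X,d,\mu)$ and $(Y,\rho,\nu)$ be metric measure spaces, where $(X,d)$ is complete and separable, $\mu$ is a Borel regular measure on $X$ that is finite on bounded sets, and $\nu$ is a Borel measure on $Y$. Let $V$ be a $\mu$ Vitali relation on $X$, let $E\subset X$ be closed and let $f:E\to Y$ be continuous. Assume that the pull-back measure $f^*\nu$ is finite on bounded sets and absolutely continuous with respect to $\mu$. Let $$J_f(x)=(V)\limsup_{S\to x}\frac{\nu\big(f(S\cap E)\big)}{\mu(S)}\qquad (x\in E).$$ Suppose that $A\subset E$ is $\mu$-measurable and that there exist pairwise disjoint $\mu$-measurable sets $E_i\subset X$, $i\in\mathbb{N}=\{0,1,2,\dots\}$, such that $$\mu\Big(E\setminus\bigcup_{i\in\mathbb{N}}E_i\Big)=0,$$ the restriction of $f$ to $E_i\cap E$ is injective for every $i\ge 1$, and $J_f(x)=0$ for $\mu$-a.e. $x\in E_0\cap E$. Then $$\int_A J_f(x)\,d\mu(x)=\int_Y N(f,A,y)\,d\nu(y).$$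
   Context: Measures. ''Measure'' on a set means a countably subadditive, nonnegative ($[0,\infty]$-valued) set function defined on all subsets and vanishing on $\emptyset$ (an outer measure); measurability is in the sense of Carathéodory. A Borel measure is one for which all Borel sets are measurable; it is Borel regular if moreover every set is contained in a Borel set of the same measure. A measure $\zeta$ on $X$ is absolutely continuous with respect to $\mu$ if $\mu(A)=0$ implies $\zeta(A)=0$, for $A\subset X$. Vitali relation. A covering relation on $X$ is a subset $C$ of $\{(x,S): x\in S\subset X\}$. For $Z\subset X$ put $C(Z)=\{S: (x,S)\in C \text{ for some } x\in Z\}$. $C$ is fine at $x$ if $\inf\{\mathrm{diam}(S): (x,S)\in C\}=0$. A $\mu$ Vitali relation is a covering relation $V$ such that $V(X)$ is a family of Borel subsets of $X$, $V$ is fine at each point of $X$, and the following holds: whenever $C\subset V$, $Z\subset X$ and $C$ is fine at each point of $Z$, the family $C(Z)$ has a countable disjoint subfamily covering $\mu$-almost all of $Z$. Limits along $V$. For an extended-real-valued function $\varphi$ of sets $S$ with domain $\mathrm{dmn}(\varphi)$, $$(V)\limsup_{S\to x}\varphi(S)=\lim_{\varepsilon\to0^+}\sup\{\varphi(S): (x,S)\in V,\ S\in \mathrm{dmn}(\varphi),\ \mathrm{diam}(S)<\varepsilon\}.$$ For a quotient with denominator $\mu(S)$, the indeterminate expression $0/0$ is regarded as undefined, i.e. such $S$ are not in the domain. Pull-back measure. For $S\subset E$ put $\zeta(S)=\nu(f(S))$. For $A\subset E$ and $\delta>0$ let $$\phi_\delta(A)=\inf\Big\{\sum_{B\in G}\zeta(B):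 G \text{ a countable family of Borel subsets of } E \text{ of diameter}\le\delta,\ A\subset\bigcup_{B\in G} B\Big\},$$ and $f^*\nu(A)=\sup_{\delta>0}\phi_\delta(A)$ (Carathéodory's construction applied with $\zeta$ on the family of Borel sets). It is extended to all $A\subset X$ by $f^*\nu(A)=f^*\nu(A\cap E)$. Multiplicity function. For $A\subset E$ and $y\in Y$, $N(f,A,y)=\#\big(A\cap f^{-1}(y)\big)\in\{0,1,2,\dots\}\cup\{\infty\}$. *)

(* Defs.v *)
From HB Require Import structures.
From mathcomp Require Import all_boot all_order all_algebra.
From mathcomp Require Import all_classical all_reals all_analysis.

Set Implicit Arguments.
Unset Strict Implicit.
Unset Printing Implicit Defensive.

Import Order.TTheory GRing.Theory Num.Theory.
Import numFieldNormedType.Exports.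

Local Open Scope classical_set_scope.
Local Open Scope ring_scope.
Local Open Scope ereal_scope.

(* Measurable types of the library are pointed; hence so are the metric spaces
   here (Complete already contains isPointed). *)
#[short(type="pMetricType")]
HB.structure Definition PMetric (K : numDomainType) :=
  {T of Metric K T & isPointed T}.

#[short(type="completeMetricType")]
HB.structure Definition CompleteMetric (K : numDomainType) :=
  {T of Metric K T & Complete T}.

Section metric_space.
Context {R : realType} {X : metricType R}.
Implicit Types (x : X) (S Z : set X) (C V : set (X * set X)).

Definition separable_space (T : topologicalType) : Prop :=
  exists2 D : set T, countable D & dense D.

Definition borel_set : set (set X) := <<s (@open X) >>.

(* The element 0 only serves to make the diameter of the empty set 0. *)
Definition diam S : \bar R :=
  ereal_sup (0 |` [set (mdist p.1 p.2)%:E | p in S `*` S]).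

Definition finite_on_bounded (zeta : set X -> \bar R) : Prop :=
  forall S, diam S < +oo -> zeta S < +oo.

Definition borel_measure (mu : {outer_measure set X -> \bar R}) : Prop :=
  borel_set `<=` mu.-caratheodory.

Definition borel_regular (mu : {outer_measure set X -> \bar R}) : Prop :=
  borel_measure mu /\
  forall A, exists B, [/\ borel_set B, A `<=` B & mu B = mu A].

Definition abs_continuous (zeta mu : set X -> \bar R) : Prop :=
  forall A, mu A = 0 -> zeta A = 0.

Definition covering_relation C : Prop := forall x S, C (x, S) -> S x.

Definition relation_family C Z : set (set X) :=
  [set S | exists2 x, Z x & C (x, S)].

Definition fine_at C x : Prop :=
  ereal_inf [set diam S | S in [set S | C (x, S)]] = 0.

Definition vitali_relation (mu : {outer_measure set X -> \bar R}) V : Prop :=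
  [/\ covering_relation V,
      relation_family V setT `<=` borel_set,
      (forall x, fine_at V x) &
      forall C Z, C `<=` V -> (forall x, Z x -> fine_at C x) ->
        exists G : set (set X),
          [/\ G `<=` relation_family C Z, countable G, trivIset G id &
              mu (Z `\` \bigcup_(S in G) S) = 0]].

(* phi is only considered on its domain dom; ereal_sup set0 is -oo. *)
Definition vitali_limsup V (dom : set (set X)) (phi : set X -> \bar R) x
    : \bar R :=
  lim ((fun e : R => ereal_sup
    [set phi S | S in [set S | [/\ V (x, S), dom S & diam S < e%:E]]]) @ 0^'+).

End metric_space.

(* A map f : E -> Y is represented by a map f : X -> Y of which only the values
   on E are used. *)
Section pullback.
Context {R : realType} {X Y : metricType R}.
Variables (E : set X) (f : X -> Y) (nu : {outer_measure set Y -> \bar R}).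

(* E is closed below, so the Borel subsets of the subspace E are the Borel
   subsets of X contained in E. *)
Definition pullback_premeasure (delta : R) (A : set X) : \bar R :=
  ereal_inf [set \esum_(B in G) nu (f @` B) | G in
    [set G : set (set X) |
      [/\ countable G,
          (forall B, G B ->
             [/\ borel_set B, B `<=` E & diam B <= delta%:E]) &
          A `<=` \bigcup_(B in G) B]]].

Definition pullback_measure (A : set X) : \bar R :=
  ereal_sup [set pullback_premeasure delta (A `&` E) | delta in
    [set delta : R | (0 < delta)%R]].

Definition multiplicity (A : set X) (y : Y) : \bar R :=
  counting (A `&` f @^-1` [set y]).

(* In the library r / 0 = +oo for r > 0. The value of +oo / +oo does not matter
   when mu is finite on bounded sets: it can only occur for unbounded S. *)
Definition vitali_jacobian (mu : {outer_measure set X -> \bar R})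
    (V : set (X * set X)) (x : X) : \bar R :=
  vitali_limsup V
    [set S | ~ (nu (f @` (S `&` E)) = 0 /\ mu S = 0)]
    (fun S => nu (f @` (S `&` E)) / mu S) x.

End pullback.

(* Main.v *)
Require Import Defs.
From HB Require Import structures.
From mathcomp Require Import all_boot all_order all_algebra finmap.
From mathcomp Require Import all_classical all_reals all_analysis.
From mathcomp Require Import measurable_realfun lra.

Set Implicit Arguments.
Unset Strict Implicit.
Unset Printing Implicit Defensive.

Import Order.TTheory GRing.Theory Num.Theory.
Import numFieldNormedType.Exports.

Local Open Scope classical_set_scope.
Local Open Scope ring_scope.
Local Open Scope ereal_scope.

(**
Put m(A) = \int N(f, A & E, y) dnu(y). The theorem says that J_f is a density of
m with respect to mu, so the proof shows first that m is a measure, absolutely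
continuous with respect to mu and finite on bounded sets, and then that its
Radon-Nikodym density equals J_f almost everywhere on E.

The measure m. The images f(A & E) of mu-measurable sets A are nu-measurable; no
theory of analytic sets is needed for this. Indeed, X being complete and
separable, A & E is the union of countably many compact sets and of a mu-null
set [compact_exhaustion]; compact sets have closed images, and
nu(f(N & E)) <= f^*nu(N) = 0 when mu(N) = 0, by absolute continuity
[null_image]. If A is covered, for each n, by countably many sets of diameter
at most 1/(n+1), then for n large the sets of the n-th cover separate any given
finite part of the fibre of f over y, so that the number of them whose image
contains y is eventually at least the cardinality of that part
[card_le_fine_cover]. Applied to Borel partitions of X this shows that N(f, A, y)
is a measurable function of y; applied to almost optimal covers in the definition
of f^*nu, together with Fatou's lemma, it gives m(A) <= f^*nu(A)
[multiplicity_measure_le_pullback], so that m is finite on bounded sets.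
Countable additivity of m is that of the counting measure. Let g be the density
of m [sigma_finite_density].

The comparison of J_f and g. Two consequences of the Vitali property are used.
- If J_f > t on Z, then t mu(Z) <= m(W) for each open set W containing Z
  [jacobian_gt_estimate]: cover Z by disjoint sets S inside W such that
  t mu(S) <= nu(f(S & E)) <= m(S).
- If J_f < s on Z and W is an open set containing Z, then Z is contained in a
  measurable set Z' such that nu(f(Z' & E)) <= s mu(W) [jacobian_lt_estimate].

By the first one and outer regularity, the sets {g < s < t < J_f} are mu-null.
The second one handles the sets {J_f < s < t < g} inside E_i with i >= 1, since
there m(A) = nu(f(A)) by injectivity. On the part of E_0 where J_f = 0 it gives
nu(f(A)) = 0, hence m(A) = 0, and the same comparison applies. The measure nu
need not be Borel regular: this is why Z' is constructed in X together with the
bound, rather than as a hull of f(Z) in Y. Since mu restricted to its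
Caratheodory sigma-algebra is complete, J_f = g almost everywhere on E also
yields the measurability of J_f.
*)

(** * Countable families, null sets and bounded sets *)

Section countable_families.
Context {R : realType} {T : Type}.

(** A countable family of sets is the range of a sequence in which each member
    occurs once, up to additional empty terms, so that neither sums over the
    family nor its disjointness are affected. *)
Lemma countable_family_seq (G : set (set T)) : countable G ->
  exists s : nat -> set T,
    [/\ forall n, G (s n) \/ s n = set0,
        \bigcup_(S in G) S = \bigcup_n s n,
        trivIset G id -> trivIset setT s &
        forall a : set T -> \bar R, (forall S, 0 <= a S) -> a set0 = 0 ->
          \esum_(S in G) a S = \sum_(n <oo) a (s n)].
Proof.
move=> /countable_injP[h hinj].
(* The n-th term is the member with index n, if there is one. *)
pose P n S := G S /\ h S = n.
pose s n := if pselect (exists S, P n S) is left e then sval (cid e) else set0.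
have sh S : G S -> s (h S) = S.
  move=> GS; rewrite /s; case: pselect => [e|]; last by case; exists S.
  by case: cid => S' /= [GS' hS']; apply: hinj; rewrite ?inE.
have sG n : (exists2 S, G S & n = h S) \/ s n = set0.
  rewrite /s; case: pselect => [e|_]; last by right.
  by left; have [S [GS hS]] := e; exists S.
exists s; split.
- by move=> n; have [[S GS ->]|] := sG n; [left; rewrite sh|right].
- apply/seteqP; split=> [x [S GS Sx]|x [n _ snx]].
    by exists (h S) => //; rewrite sh.
  have [[S GS nS]|sn0] := sG n; last by move: snx; rewrite sn0.
  by exists S => //; rewrite -(sh S GS) -nS.
- move=> tG i j _ _ ij.
  have [[S GS iS]|si0] := sG i; last by case: ij => x []; rewrite si0.
  have [[S' GS' jS]|sj0] := sG j; last by case: ij => x []; rewrite sj0.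
  move: ij; rewrite iS jS !sh// => ij; congr h; exact: tG.
- move=> a a0 a00; rewrite nneseries_esumT; last by move=> n; exact: a0.
  rewrite (eq_esum (b := fun S => a (s (h S)))); last by move=> S GS; rewrite sh.
  rewrite -(esum_image G h (fun n => a (s n))); last exact: hinj.
  rewrite esum_mkcond; apply: eq_esum => n _; case: ifPn => //.
  rewrite notin_setE => nG; have [[S GS nS]|->] := sG n; last by rewrite a00.
  by exfalso; apply: nG; exists S.
Qed.

End countable_families.

Section null_sets.
Context {R : realType} {T : Type}.
Variable mu : {outer_measure set T -> \bar R}.

Lemma outer_measure_null_le (A B : set T) : A `<=` B -> mu B = 0 -> mu A = 0.
Proof.
move=> AB B0; apply/eqP; rewrite eq_le outer_measure_ge0 andbT -B0.
exact: le_outer_measure.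
Qed.

Lemma outer_measure_null_bigcup (I : countType) (F : I -> set T) :
  (forall i, mu (F i) = 0) -> mu (\bigcup_i F i) = 0.
Proof.
move=> F0; pose F' n := if choice.unpickle n is Some i then F i else set0.
apply: (@outer_measure_null_le _ (\bigcup_n F' n)).
  by move=> x [i _ Fx]; exists (choice.pickle i) => //; rewrite /F' choice.pickleK.
apply/eqP; rewrite eq_le outer_measure_ge0 andbT.
apply: (le_trans (outer_measure_sigma_subadditive mu F')).
rewrite eseries0// => n _ _; rewrite /F'.
by case: choice.unpickle => [i|] //; rewrite outer_measure0.
Qed.

Lemma outer_measure_le_null (A B N : set T) :
  A `<=` B `|` N -> mu N = 0 -> mu A <= mu B.
Proof.
move=> ABN N0; apply: (le_trans (le_outer_measure mu _ _ ABN)).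
by apply: (le_trans (outer_measureU2 mu _ _)); rewrite N0 adde0.
Qed.

Lemma outer_measure_le_series (A N : set T) (s : nat -> set T) :
  A `<=` (\bigcup_n s n) `|` N -> mu N = 0 -> mu A <= \sum_(n <oo) mu (s n).
Proof.
move=> AsN N0; apply: (le_trans (outer_measure_le_null AsN N0)).
exact: outer_measure_sigma_subadditive.
Qed.

Lemma caratheodory_null (N : set T) : mu N = 0 -> mu.-caratheodory N.
Proof.
move=> N0; apply: le_caratheodory_measurable => Z.
rewrite (outer_measure_null_le (@subIsetr _ _ _) N0) add0e.
by apply: le_outer_measure; exact: subIsetl.
Qed.

End null_sets.

Section bounded_sets.
Context {R : realType} {X : metricType R}.
Implicit Types (x y : X) (S : set X).

Lemma diam_ge0 S : 0 <= diam S.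
Proof. by apply: ereal_sup_ubound; left. Qed.

Lemma mdist_le_diam S x y : S x -> S y -> (mdist x y)%:E <= diam S.
Proof.
by move=> Sx Sy; apply: ereal_sup_ubound; right; exists (x, y).
Qed.

Lemma diam_le S (r : R) : (0 <= r)%R ->
  (forall x y, S x -> S y -> (mdist x y <= r)%R) -> diam S <= r%:E.
Proof.
move=> r0 Sr; apply: ge_ereal_sup => _ [->|[[x y] [/= Sx Sy] <-]].
  by rewrite lee_fin.
by rewrite lee_fin Sr.
Qed.

Lemma le_diam S S' : S `<=` S' -> diam S <= diam S'.
Proof.
move=> SS'; apply: le_ereal_sup => _ [->|[[x y] [/= Sx Sy] <-]]; [by left|right].
by exists (x, y) => //; split; exact: SS'.
Qed.

Lemma diam_ball x (r : R) : (0 < r)%R -> diam (ball x r) <= (r + r)%:E.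
Proof.
move=> r0; apply: diam_le; first by rewrite addr_ge0// ltW.
rewrite ballEmdist => y z /= xy xz.
by rewrite (le_trans (metric_triangle y x z))// metric_sym lerD// ltW.
Qed.

Lemma subset_ball S x (r : R) : S x -> diam S < r%:E -> S `<=` ball x r.
Proof.
move=> Sx Sr y Sy; rewrite ballEmdist/= -lte_fin.
exact: le_lt_trans (mdist_le_diam Sx Sy) Sr.
Qed.

Lemma fine_atP (C : set (X * set X)) x :
  (forall e : R, (0 < e)%R -> exists2 S, C (x, S) & diam S < e%:E) <->
  fine_at C x.
Proof.
split=> [Ce|fC e e0].
  apply/eqP; rewrite eq_le; apply/andP; split; last first.
    by apply: le_ereal_inf_tmp => _ [S _ <-]; exact: diam_ge0.
  apply/lee_addgt0Pr => e e0; rewrite add0e.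
  have [S CS Se] := Ce _ e0; apply: le_trans (ltW Se).
  by apply: ereal_inf_lbound; exists S.
have : ereal_inf [set diam S | S in [set S | C (x, S)]] < e%:E.
  by rewrite fC lte_fin.
by move=> /ereal_inf_lt[_ [S CS <-] Se]; exists S.
Qed.

Lemma bigcup_ball (x0 : X) : \bigcup_n ball x0 n.+1%:R = setT.
Proof.
apply/seteqP; split=> // x _; exists (Num.truncn (mdist x0 x)) => //.
by rewrite ballEmdist/=; rewrite truncnS_gt.
Qed.

Lemma finite_on_ball (zeta : set X -> \bar R) x (r : R) :
  finite_on_bounded zeta -> zeta (ball x r) < +oo.
Proof.
move=> fz; apply: fz; have [r0|r0] := ltP 0%R r.
  by apply: le_lt_trans (diam_ball x r0) _; rewrite ltry.
apply: (@le_lt_trans _ _ 0%:E); last by rewrite ltry.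
apply: diam_le => // y z; rewrite ballEmdist/= => xy _.
by have := lt_le_trans xy r0; rewrite ltNge mdist_ge0.
Qed.

End bounded_sets.

(** * Regularity of finite Borel measures *)

Section borel_sets.
Context {R : realType} {X : metricType R}.
Implicit Types (A B : set X).

Lemma borel_set_sigma_algebra : sigma_algebra setT (@borel_set R X).
Proof. exact: smallest_sigma_algebra. Qed.

Lemma borel_open A : open A -> borel_set A.
Proof. exact: sub_sigma_algebra. Qed.

Lemma borel_setC A : borel_set A -> borel_set (~` A).
Proof.
by move=> bA; rewrite -setTD; have [_ + _] := borel_set_sigma_algebra; apply.
Qed.

Lemma borel_closed A : closed A -> borel_set A.
Proof.
by move=> cA; rewrite -[A]setCK; apply: borel_setC; apply: borel_open; rewrite openC.
Qed.

Lemma borel_bigcup (F : nat -> set X) :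
  (forall n, borel_set (F n)) -> borel_set (\bigcup_n F n).
Proof. by move=> bF; have [_ _ +] := borel_set_sigma_algebra; apply. Qed.

Lemma borel_set0 : borel_set (@set0 X).
Proof. exact: (borel_open open0). Qed.

Lemma borel_setU A B : borel_set A -> borel_set B -> borel_set (A `|` B).
Proof.
move=> bA bB; rewrite -bigcup2E; apply: borel_bigcup => -[|[|n]] //=.
exact: borel_set0.
Qed.

Lemma borel_setI A B : borel_set A -> borel_set B -> borel_set (A `&` B).
Proof.
move=> bA bB; rewrite -[_ `&` _]setCK setCI.
by apply: borel_setC; apply: borel_setU; exact: borel_setC.
Qed.

Lemma borel_setD A B : borel_set A -> borel_set B -> borel_set (A `\` B).
Proof. by move=> bA bB; rewrite setDE; apply: borel_setI => //; exact: borel_setC. Qed.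

Lemma metric_ball_open (x : X) r : open (ball x r).
Proof.
rewrite openE => y; rewrite {1}ballEmdist/= => xy; apply/nbhs_ballP.
exists (r - mdist x y)%R => /=; first by rewrite subr_gt0.
move=> z; rewrite !ballEmdist/= => yz.
by have := metric_triangle x y z; lra.
Qed.

Lemma ball_borel (x : X) r : borel_set (ball x r).
Proof. exact: (borel_open (metric_ball_open _ _)). Qed.

Lemma mdist_le_closed (x : X) (r : R) : closed [set y | (mdist x y <= r)%R].
Proof.
rewrite -openC (_ : ~` _ = [set y | (r < mdist x y)%R]); last first.
  by apply/seteqP; split=> y /=; rewrite ltNge => /negP.
rewrite openE => y /= ry; apply/nbhs_ballP.
exists (mdist x y - r)%R => /=; first by rewrite subr_gt0.
move=> z; rewrite ballEmdist/= => yz.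
by have := metric_triangle x z y; rewrite (metric_sym z); lra.
Qed.

(** The points whose ball of radius 1/(n+1) lies in O: an increasing sequence of
    closed sets with union O when O is open. *)
Definition inner_part (O : set X) (n : nat) : set X :=
  [set x | ball x n.+1%:R^-1 `<=` O].

Lemma inner_part_closed O n : closed (inner_part O n).
Proof.
move=> x cx y; rewrite ballEmdist/= => xy.
have e0 : (0 < n.+1%:R^-1 - mdist x y)%R by rewrite subr_gt0.
have [z [/= Oz]] := cx _ (nbhsx_ballx x _ e0).
rewrite ballEmdist/= => xz; apply: Oz; rewrite ballEmdist/=.
have := metric_triangle z x y; rewrite (metric_sym z x) => /le_lt_trans; apply.
by rewrite -ltrBrDr.
Qed.

Lemma inner_part_nondecreasing O m n : (m <= n)%N ->
  inner_part O m `<=` inner_part O n.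
Proof.
move=> mn x Ox; apply: subset_trans Ox; apply: le_ball.
by rewrite lef_pV2 ?posrE// ler_nat.
Qed.

Lemma bigcup_inner_part O : open O -> \bigcup_n inner_part O n = O.
Proof.
move=> oO; apply/seteqP; split=> [x [n _]|x Ox].
  by apply; exact: ballxx.
move: oO; rewrite openE => /(_ _ Ox)/nbhs_ballP[e /= e0 xeO].
exists (Num.truncn e^-1) => // y xy; apply: xeO; apply: le_ball xy.
rewrite -[leRHS]invrK lef_pV2 ?posrE ?invr_gt0//.
exact/ltW/truncnS_gt.
Qed.

End borel_sets.

Section regularity.
Context {d} {T : measurableType d} {R : realType}.
Variable pi : {measure set T -> \bar R}.
Hypothesis pi_fin : pi setT < +oo.

(** Continuity from above, in the form of the choice of an index. *)
Lemma finite_measure_bigcap_lt (F : nat -> set T) (e : \bar R) :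
  (forall n, measurable (F n)) ->
  {homo F : n m / (n <= m)%N >-> m `<=` n} ->
  pi (\bigcap_n F n) < e -> exists n, pi (F n) < e.
Proof.
move=> mF dF Fe; apply: contrapT => /forallNP nF.
have cF : pi \o F @ \oo --> pi (\bigcap_n F n).
  apply: nonincreasing_cvg_mu => //.
  - by apply: le_lt_trans pi_fin; rewrite le_measure ?inE.
  - exact: bigcapT_measurable.
  - by move=> m n mn; apply/subsetPset; exact: dF.
suff : e <= pi (\bigcap_n F n) by rewrite leNgt Fe.
rewrite -(cvg_lim _ cF)//; apply: lime_ge; first by apply/cvg_ex; eexists; exact: cF.
by apply: nearW => n; rewrite leNgt; apply/negP; exact: nF.
Qed.

End regularity.

Section borel_regularity.
Context {R : realType} {X : pMetricType R}.
Variable mu : {outer_measure set X -> \bar R}.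
Hypothesis bmu : borel_measure mu.
Variable pi : {measure set (caratheodory_type mu) -> \bar R}.
Hypothesis pi_fin : pi setT < +oo.

(** Every Borel set is approximated in measure by closed sets from inside and by
    open sets from outside: the sets with this property form a sigma-algebra,
    which contains the open sets. *)
Lemma closed_open_approx (B : set X) : borel_set B -> forall e : R, (0 < e)%R ->
  exists F U, [/\ closed F, open U, F `<=` B, B `<=` U & pi (U `\` F) < e%:E].
Proof.
have mB A : borel_set A -> mu.-cara.-measurable A by exact: bmu.
pose C : set (set X) := [set B | forall e : R, (0 < e)%R ->
  exists F U, [/\ closed F, open U, F `<=` B, B `<=` U & pi (U `\` F) < e%:E]].
suff : @borel_set R X `<=` C by apply.
apply: smallest_sub; last first.
  move=> U oU e e0.
  have [n en] : exists n, pi (U `\` inner_part U n) < e%:E.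
    apply: (finite_measure_bigcap_lt pi_fin (F := fun n => U `\` inner_part U n)).
    - move=> n; apply: mB; apply: borel_setD; first exact: borel_open.
      exact: (borel_closed (@inner_part_closed _ _ _ _)).
    - by move=> m n mn; apply: setDS; exact: inner_part_nondecreasing.
    - rewrite (_ : \bigcap_n _ = set0) ?measure0 ?lte_fin//.
      rewrite -subset0 => x Fx; have [Ox _] := Fx 0%N I.
      move: Ox; rewrite -{1}(bigcup_inner_part oU) => -[n _ Ox].
      by have [_] := Fx n I.
  exists (inner_part U n), U; split => //; first exact: inner_part_closed.
  by rewrite -[X in _ `<=` X](bigcup_inner_part oU); exact: bigcup_sup.
split.
- move=> e e0; exists set0, set0; split => //; first exact: closed0.
    exact: open0.
  by rewrite setD0 measure0 lte_fin.
- move=> A CA e e0; have [F [U [cF oU FA AU AUe]]] := CA _ e0.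
  exists (~` U), (~` F); split => //.
  + exact: open_closedC.
  + exact: closed_openC.
  + by rewrite setTD; exact: subsetC.
  + by rewrite setTD; exact: subsetC.
  + by rewrite setDE setCK setIC -setDE.
move=> A CA e e0.
have e2 n : (0 < (e / 2) / (2 ^ n.+1)%:R)%R.
  by rewrite !divr_gt0// ltr0n expn_gt0.
have /choice[FU FUP] n : exists p : set X * set X,
  [/\ closed p.1, open p.2, p.1 `<=` A n, A n `<=` p.2 &
    pi (p.2 `\` p.1) < ((e / 2) / (2 ^ n.+1)%:R)%:E].
  by have [F [U FUP]] := CA n _ (e2 n); exists (F, U).
pose U := \bigcup_n (FU n).2.
have oU : open U by apply: bigcup_open => n _; have [] := FUP n.
(* The union of all closed approximations need not be closed; a finite union
   suffices up to a small error. *)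
pose F N := \bigcup_(n in `I_N) (FU n).1.
have cF N : closed (F N).
  by apply: closed_bigcup => [|n _]; [exact: finite_II|have [] := FUP n].
have [N eN] : exists N, pi (U `\` F N) < e%:E.
  apply: (finite_measure_bigcap_lt pi_fin).
  - by move=> n; apply: mB; apply: borel_setD; [exact: borel_open|exact: borel_closed].
  - move=> m n mn; apply: setDS => x [k /= km Fx]; exists k => //=.
    exact: leq_trans mn.
  have mD n : mu.-cara.-measurable ((FU n).2 `\` (FU n).1).
    have [cF1 oU' _ _ _] := FUP n.
    by apply: mB; apply: borel_setD; [exact: borel_open|exact: borel_closed].
  apply: (@le_lt_trans _ _ (\sum_(n <oo) pi ((FU n).2 `\` (FU n).1))).
    apply: measure_sigma_subadditive => //.
    - apply: bigcapT_measurable => n; apply: mB; apply: borel_setD.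
        exact: borel_open.
      exact: borel_closed.
    move=> x Ox; have [[n _ On] _] := Ox 0%N I; exists n => //; split => // Fn.
    by have [_] := Ox n.+1 I; apply; exists n => /=.
  apply: (@le_lt_trans _ _ (e / 2)%:E); last by rewrite lte_fin; lra.
  apply: le_trans (epsilon_trick0 xpredT _); last lra.
  by apply: lee_nneseries => // n _; apply/ltW; have [] := FUP n.
exists (F N), U; split => //.
  by move=> x [n _ Fx]; exists n => //; have [_ _ + _ _] := FUP n; apply.
by move=> x [n _ Ax]; exists n => //; have [_ _ _ + _] := FUP n; apply.
Qed.

End borel_regularity.

(** * Borel hulls and compact exhaustion *)

Section compactness.
Context {R : realType} {X : completeMetricType R}.

Lemma separable_dense_seq : separable_space X ->
  exists q : nat -> X, forall x (r : R), (0 < r)%R -> exists k, (mdist (q k) x < r)%R.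
Proof.
case=> D /countable_injP[h hinj] dD.
pose P n y := D y /\ h y = n.
pose q n := if pselect (exists y, P n y) is left e then sval (cid e) else point.
exists q => x r r0.
have [y [/= xy Dy]] : ball x r `&` D !=set0.
  by apply: dD; [exists x; exact: ballxx|exact: metric_ball_open].
exists (h y); rewrite /q; case: pselect => [e|]; last by case; exists y.
case: cid => z /= [Dz hz]; rewrite (hinj z y) ?inE//.
by move: xy; rewrite ballEmdist/= metric_sym.
Qed.

Lemma ultra_bigcup (T : Type) (F : set_system T) (B : nat -> set T) N :
  UltraFilter F -> F (\bigcup_(j in `I_N) B j) -> exists j, F (B j).
Proof.
move=> UF; elim: N => [|N IH].
  by rewrite II0 bigcup_set0 => /(@filter_not_empty _ F _).
move=> FU; have [|FC] := in_ultra_setVsetC (B N) UF; first by exists N.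
apply: IH; apply: filterS (filterI FU FC) => x [[j /= + Bx] nBx].
rewrite ltnS leq_eqVlt => /orP[/eqP jN|jN]; last by exists j.
by exfalso; apply: nBx; rewrite -jN.
Qed.

Lemma closed_totally_bounded_compact (K : set X) : closed K ->
  (forall e : R, (0 < e)%R -> exists (c : nat -> X) N,
    K `<=` \bigcup_(j in `I_N) ball (c j) e) ->
  compact K.
Proof.
move=> cK tK; rewrite compact_ultra => F UF FK.
have PF : ProperFilter F by exact: ultra_proper.
have /cauchy_cvg cF : cauchy F.
  apply: cauchy_exP => e e0; have [c [N KN]] := tK _ e0.
  have [j Fj] := ultra_bigcup UF (filterS KN FK).
  by exists (c j).
exists (lim F); split; last exact: cF.
apply: cK => B lB; have FB : F B by exact: cF.
by have [x [Kx Bx]] := filter_ex (filterI FK FB); exists x.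
Qed.

Section tightness.
Variable mu : {outer_measure set X -> \bar R}.
Hypothesis bmu : borel_measure mu.
Variable pi : {measure set (caratheodory_type mu) -> \bar R}.
Hypothesis pi_fin : pi setT < +oo.
Hypothesis sX : separable_space X.

(** Tightness: for each n, all but a small part of the space is covered by
    finitely many closed balls of radius 1/(n+1) centred in a dense sequence. *)
Lemma closed_compact_approx (F : set X) (e : R) : closed F -> (0 < e)%R ->
  exists K, [/\ compact K, K `<=` F & pi (F `\` K) < e%:E].
Proof.
move=> cF e0; have [q qP] := separable_dense_seq sX.
have mB A : borel_set A -> mu.-cara.-measurable A by exact: bmu.
pose r n : R := (n.+1%:R^-1)%R.
have r0 n : (0 < r n)%R by rewrite invr_gt0.
pose cb n j := [set y | (mdist (q j) y <= r n)%R].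
pose W n k := \bigcup_(j in `I_k) cb n j.
have cW n k : closed (W n k).
  by apply: closed_bigcup => [|j _]; [exact: finite_II|exact: mdist_le_closed].
have mW n k : mu.-cara.-measurable (W n k) by apply: mB; exact: borel_closed.
have e2 n : (0 < (e / 2) / (2 ^ n.+1)%:R)%R.
  by rewrite !divr_gt0// ltr0n expn_gt0.
have /choice[k kP] n : exists k, pi (~` W n k) < ((e / 2) / (2 ^ n.+1)%:R)%:E.
  apply: (finite_measure_bigcap_lt pi_fin (F := fun k => ~` W n k)).
  - by move=> k; exact: measurableC.
  - by move=> i j ij; apply: subsetC => x [l /= li lx]; exists l => //=;
      exact: leq_trans ij.
  - rewrite (_ : \bigcap_k _ = set0) ?measure0 ?lte_fin//.
    rewrite -subset0 => x Wx; have [j jx] := qP x _ (r0 n).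
    by apply: (Wx j.+1 I); exists j => //=; exact: ltW.
pose K := F `&` \bigcap_n W n (k n).
have cK : closed K.
  by apply: closedI => //; apply: closed_bigI => n _; exact: cW.
exists K; split.
- apply: closed_totally_bounded_compact => // a a0.
  pose n := Num.truncn a^-1; exists q, (k n) => x [_ /(_ n I)[j jk xj]].
  exists j => //; rewrite ballEmdist/=; apply: (le_lt_trans xj).
  by rewrite -[ltRHS]invrK ltf_pV2 ?posrE ?invr_gt0// truncnS_gt.
- by move=> x [].
apply: (@le_lt_trans _ _ (\sum_(n <oo) pi (~` W n (k n)))).
  apply: measure_sigma_subadditive => //.
  - by move=> n; exact: measurableC.
  - by apply: mB; apply: borel_setD; exact: borel_closed.
  move=> x [Fx Kx]; apply: contrapT => Wx; apply: Kx; split => // n _.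
  by apply: contrapT => nW; apply: Wx; exists n.
apply: (@le_lt_trans _ _ (e / 2)%:E); last by rewrite lte_fin; lra.
apply: le_trans (epsilon_trick0 xpredT _); last lra.
by apply: lee_nneseries => // n _; apply/ltW; exact: kP.
Qed.

End tightness.
End compactness.

Lemma fin_num_addr_eq0 {R : realType} (x y : \bar R) :
  x \is a fin_num -> x = x + y -> y = 0.
Proof.
by case: x => [r| |]//; case: y => [s| |]//= _ [] rs; congr EFin; lra.
Qed.

Section hulls.
Context {R : realType} {X : pMetricType R}.
Variable mu : {outer_measure set X -> \bar R}.
Hypothesis rmu : borel_regular mu.
Hypothesis fmu : finite_on_bounded mu.

Let bmu : borel_measure mu := proj1 rmu.

(** Borel regularity gives hulls of the bounded parts of A, whose measures are
    finite, so that the differences are null. *)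
Lemma borel_hull (A : set X) : mu.-cara.-measurable A ->
  exists H, [/\ borel_set H, A `<=` H & mu (H `\` A) = 0].
Proof.
move=> mA; pose B n := ball (point : X) n.+1%:R.
have mB n : mu.-cara.-measurable (B n) by apply: bmu; exact: ball_borel.
have /choice[H HP] n : exists H, [/\ borel_set H, A `&` B n `<=` H &
    mu (H `\` (A `&` B n)) = 0].
  have [H [bH AH mH]] := proj2 rmu (A `&` B n); exists H; split => //.
  have mAB : mu.-cara.-measurable (A `&` B n) by exact: measurableI.
  have ABoo : mu (A `&` B n) < +oo.
    apply: (@le_lt_trans _ _ (mu (B n))).
      by apply: le_outer_measure; exact: subIsetr.
    exact: finite_on_ball.
  have := mAB H; rewrite (_ : H `&` (A `&` B n) = A `&` B n); last first.
    by apply/seteqP; split=> x; [case|move=> ABx; split => //; exact: AH].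
  rewrite mH -setDE; apply: fin_num_addr_eq0.
  by rewrite ge0_fin_numE.
exists (\bigcup_n H n); split.
- by apply: borel_bigcup => n; have [] := HP n.
- move=> x Ax; have [n _ Bx] : (\bigcup_n B n) x by rewrite bigcup_ball.
  by exists n => //; have [_ + _] := HP n; apply.
apply: (@outer_measure_null_le _ _ _ _ (\bigcup_n (H n `\` (A `&` B n)))).
  by move=> x [[n _ Hx] Ax]; exists n => //; split => // -[].
by apply: outer_measure_null_bigcup => n; have [] := HP n.
Qed.

Lemma borel_kernel (A : set X) : mu.-cara.-measurable A ->
  exists K, [/\ borel_set K, K `<=` A & mu (A `\` K) = 0].
Proof.
move=> mA; have [H [bH AH H0]] := borel_hull (measurableC mA).
exists (~` H); split; first exact: borel_setC.
  by move=> x Hx; apply: contrapT => /AH.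
by rewrite setDE setCK setIC; move: H0; rewrite setDE setCK.
Qed.

(** Outer regularity on mu-measurable sets for a finite measure which is
    absolutely continuous with respect to mu. *)
Lemma open_approx_measure (pi : {measure set (caratheodory_type mu) -> \bar R})
    (A : set X) (e : R) :
  pi setT < +oo ->
  (forall N, mu.-cara.-measurable N -> mu N = 0 -> pi N = 0) ->
  mu.-cara.-measurable A -> (0 < e)%R ->
  exists W, [/\ open W, A `<=` W & pi W <= pi A + e%:E].
Proof.
move=> pifin pimu mA e0; have [H [bH AH H0]] := borel_hull mA.
have mB B : borel_set B -> mu.-cara.-measurable B by exact: bmu.
have [F [U [cF oU FH HU eU]]] := closed_open_approx bmu pifin bH e0.
exists U; split => //; first exact: subset_trans HU.
have mU := mB _ (borel_open oU); have mH := mB _ bH; have mF := mB _ (borel_closed cF).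
have mHA : mu.-cara.-measurable (H `\` A) by exact: measurableD.
have mUH : mu.-cara.-measurable (U `\` H) by exact: measurableD.
have -> : U = A `|` (H `\` A) `|` (U `\` H).
  rewrite (setDUK AH) ?(setDUK HU)//.
apply: (le_trans (measureU2 pi _ _)) => //; first exact: measurableU.
apply: leeD.
  apply: (le_trans (measureU2 pi _ _)) => //.
  by rewrite [X in _ + X]pimu ?adde0.
apply: ltW; apply: le_lt_trans eU; apply: le_measure; rewrite ?inE//.
  exact: measurableD.
exact: setDS.
Qed.

(** Outer regularity of mu on arbitrary bounded sets. *)
Lemma open_approx_outer (Z : set X) (x : X) (r : R) (e : R) :
  Z `<=` ball x r -> (0 < e)%R ->
  exists W, [/\ open W, Z `<=` W, W `<=` ball x r & mu W <= mu Z + e%:E].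
Proof.
move=> Zx e0; have [H [bH ZH mH]] := proj2 rmu Z.
have mb : mu.-cara.-measurable (ball x r) by apply: bmu; exact: ball_borel.
pose pi := mrestr (mu : set (caratheodory_type mu) -> \bar R) mb.
have [||||W [oW HW We]] := @open_approx_measure pi H e.
- by rewrite /pi/= /mrestr setTI; exact: finite_on_ball.
- move=> N mN N0; rewrite /pi/= /mrestr.
  exact: (outer_measure_null_le (@subIsetl _ _ _)).
- exact: bmu.
- by [].
exists (W `&` ball x r); split.
- by apply: openI => //; exact: metric_ball_open.
- by move=> z Zz; split; [exact/HW/ZH|exact: Zx].
- exact: subIsetr.
apply: (le_trans We); rewrite leeD2r// -mH.
by apply: le_outer_measure; exact: subIsetl.
Qed.

End hulls.

Section inner_regularity.
Context {R : realType} {X : completeMetricType R}.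
Variable mu : {outer_measure set X -> \bar R}.
Hypothesis rmu : borel_regular mu.
Hypothesis fmu : finite_on_bounded mu.
Hypothesis sX : separable_space X.

(** In a complete separable space a measurable set is the union of countably many
    compact sets and of a null set. *)
Lemma compact_exhaustion (A : set X) : mu.-cara.-measurable A ->
  exists K : nat * nat -> set X, [/\ forall i, compact (K i), forall i, K i `<=` A &
    mu (A `\` \bigcup_i K i) = 0].
Proof.
move=> mA; have bmu := proj1 rmu.
have mB B : borel_set B -> mu.-cara.-measurable B by exact: bmu.
have [H [bH HA A0]] := borel_kernel rmu fmu mA.
have mb n : mu.-cara.-measurable (ball (point : X) n.+1%:R).
  by apply: bmu; exact: ball_borel.
pose pi n := mrestr (mu : set (caratheodory_type mu) -> \bar R) (mb n).
have pifin n : pi n setT < +oo.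
  by rewrite /pi/= /mrestr setTI; exact: finite_on_ball.
have e0 k : (0 < k.+1%:R^-1 :> R)%R by rewrite invr_gt0.
have /choice[K KP] (i : nat * nat) : exists K, [/\ compact K, K `<=` H &
    pi i.1 (H `\` K) < (i.2.+1%:R^-1 + i.2.+1%:R^-1)%:E].
  have [F [U [cF oU FH HU eU]]] := closed_open_approx bmu (pifin i.1) bH (e0 i.2).
  have [K [cK KF eK]] := closed_compact_approx bmu (pifin i.1) sX cF (e0 i.2).
  exists K; split => //; first exact: subset_trans FH.
  have mH := mB _ bH; have mF := mB _ (borel_closed cF).
  have mK := mB _ (borel_closed (compact_closed (@metric_hausdorff _ X) cK)).
  rewrite EFinD; apply: le_lt_trans (lteD eU eK).
  have mU := mB _ (borel_open oU).
  have m1 : mu.-cara.-measurable (U `\` F) by exact: measurableD.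
  have m2 : mu.-cara.-measurable (F `\` K) by exact: measurableD.
  apply: le_trans (measureU2 (pi i.1) m1 m2).
  apply: le_measure; rewrite ?inE; [exact: measurableD|exact: measurableU|].
  move=> x [Hx Kx]; have [Fx|Fx] := pselect (F x); [by right|left].
  by split => //; exact: HU.
exists K; split.
- by move=> i; have [] := KP i.
- by move=> i; apply: subset_trans HA; have [] := KP i.
apply: (@outer_measure_null_le _ _ _ _ ((A `\` H) `|` \bigcup_n
    ((H `\` \bigcup_i K i) `&` ball (point : X) n.+1%:R))).
  move=> x [Ax Kx]; have [Hx|Hx] := pselect (H x); [right|by left].
  have [n _ Bx] : (\bigcup_n ball (point : X) n.+1%:R) x by rewrite bigcup_ball.
  by exists n.
apply/eqP; rewrite eq_le outer_measure_ge0 andbT.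
apply: (le_trans (outer_measureU2 mu _ _)); rewrite A0 add0e.
rewrite outer_measure_null_bigcup// => n.
apply/eqP; rewrite eq_le outer_measure_ge0 andbT; apply/lee_addgt0Pr => a a0.
rewrite add0e; pose k := Num.truncn (a / 2)^-1.
have [_ _ /ltW Kk] := KP (n, k).
apply: (@le_trans _ _ (k.+1%:R^-1 + k.+1%:R^-1)%:E).
  apply: le_trans Kk; rewrite /pi/= /mrestr; apply: le_outer_measure.
  by apply: setSI; apply: setDS; exact: bigcup_sup.
rewrite lee_fin [leRHS](splitr a).
suff : (k.+1%:R^-1 <= a / 2)%R by move=> h; exact: lerD.
by rewrite -[leRHS]invrK lef_pV2 ?posrE ?invr_gt0 ?divr_gt0//; apply/ltW/truncnS_gt.
Qed.

End inner_regularity.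

(** * The multiplicity function *)

Section counting_sums.
Context {R : realType} {T : choiceType}.
Implicit Types (S : set T).

Lemma fset_sum1 (I : Type) (s : seq I) :
  \sum_(i <- s) (1 : \bar R) = (size s)%:R%:E.
Proof.
elim: s => [|i s IH]; first by rewrite big_nil.
by rewrite big_cons IH -EFinD -natr1 addrC.
Qed.

(** A cardinality, possibly infinite, is bounded as soon as those of the finite
    subsets are. *)
Lemma counting_le S (c : \bar R) :
  (forall P : {fset T}, [set` P] `<=` S -> (#|` P|)%:R%:E <= c) ->
  counting S <= c.
Proof.
rewrite /counting; case: asboolP => [finS|infS] Pc.
  by apply: Pc; rewrite fset_setK.
have nc (n : nat) : n%:R%:E <= c.
  have [P PS nP] := infinite_set_fset n infS.
  by apply: le_trans (Pc _ PS); rewrite lee_fin ler_nat.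
case: c nc {Pc} => [r| |] nc //; last by have := nc 0%N.
have := nc (Num.truncn r).+1.
by rewrite lee_fin leNgt truncnS_gt.
Qed.

Lemma counting_esum S : counting S = \esum_(x in S) (1 : \bar R).
Proof.
apply/eqP; rewrite eq_le; apply/andP; split.
  apply: counting_le => P PS; apply: esum_ge; exists [set` P].
    by split => //; exact: finite_fset.
  by rewrite fsbig_finite//= set_fsetK fset_sum1.
apply: ge_ereal_sup => _ [F [finF FS] <-].
rewrite fsbig_finite//= fset_sum1 /counting; case: asboolP => [finS|_].
  rewrite lee_fin ler_nat; apply: fsubset_leq_card; rewrite -fset_set_sub//.
by rewrite leey.
Qed.

Lemma counting_nonneg S : 0 <= counting S :> \bar R.
Proof. by rewrite counting_esum; apply: esum_ge0. Qed.

Lemma counting_set0 : counting (@set0 T) = 0 :> \bar R.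
Proof. by rewrite counting_esum esum_set0. Qed.

Lemma counting_bigcup (F : nat -> set T) : trivIset setT F ->
  counting (\bigcup_n F n) = \sum_(n <oo) counting (F n) :> \bar R.
Proof.
move=> tF; rewrite counting_esum nneseries_sum_bigcup//.
by under eq_eseriesr do rewrite -counting_esum.
Qed.

Lemma counting_ge1 S : S !=set0 -> 1 <= counting S :> \bar R.
Proof.
case=> x Sx; rewrite counting_esum; apply: esum_ge; exists [set x].
  by split => // y ->.
by rewrite fsbig_set1.
Qed.

Lemma le_counting S S' : S `<=` S' -> counting S <= counting S' :> \bar R.
Proof.
move=> SS'; rewrite !counting_esum; apply: ge_ereal_sup => _ [F [finF FS] <-].
by apply: esum_ge; exists F => //; split => //; exact: subset_trans SS'.
Qed.

End counting_sums.

Section multiplicity_covers.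
Context {R : realType} {X Y : metricType R}.
Implicit Types (f : X -> Y) (A : set X) (y : Y).

Lemma le_multiplicity f A B y :
  A `<=` B -> multiplicity f A y <= multiplicity f B y :> \bar R.
Proof. by move=> AB; apply: le_counting; exact: setSI. Qed.

Lemma multiplicity_ge_indic f A y :
  (\1_(f @` A) y)%:E <= multiplicity f A y :> \bar R.
Proof.
rewrite indicE; have [|_] := boolP (y \in f @` A); last exact: counting_nonneg.
by rewrite inE => -[x Ax fx]; apply: counting_ge1; exists x.
Qed.

Lemma multiplicity_inj f A y : {in A &, injective f} ->
  multiplicity f A y = (\1_(f @` A) y)%:E :> \bar R.
Proof.
move=> finj; rewrite indicE; have [|] := boolP (y \in f @` A).
  rewrite inE => -[x Ax <-]; rewrite /multiplicity.
  rewrite (_ : _ `&` _ = [set x]) ?counting_esum ?esum_set1//.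
  apply/seteqP; split=> z /=; last by move=> ->.
  by move=> [Az fz]; apply: finj; rewrite ?inE.
rewrite notin_setE => yA; rewrite /multiplicity (_ : _ `&` _ = set0) ?counting_set0//.
by rewrite -subset0 => x [Ax fx]; apply: yA; exists x.
Qed.

Lemma multiplicity_bigcup f (F : nat -> set X) y : trivIset setT F ->
  multiplicity f (\bigcup_n F n) y = \sum_(n <oo) multiplicity f (F n) y :> \bar R.
Proof.
move=> tF; rewrite /multiplicity setI_bigcupl counting_bigcup//.
by apply: trivIset_setIr.
Qed.

(** Once the covers are finer than the smallest distance between two points of a
    finite part P of a fibre, distinct points of P lie in distinct sets. *)
Lemma card_le_fine_cover (P : {fset X}) (s : nat -> nat -> set X) f y :
  (forall x, x \in P -> f x = y) ->
  (forall n k, diam (s n k) <= (n.+1%:R^-1)%:E) ->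
  (forall n x, x \in P -> exists k, s n k x) ->
  \forall n \near \oo, (#|` P|)%:R%:E <= \sum_(k <oo) (\1_(f @` s n k) y)%:E :> \bar R.
Proof.
move=> fP ds sP.
have sep : \forall n \near \oo, forall p, p \in (P `*` P)%fset ->
    p.1 != p.2 -> (n.+1%:R^-1 < mdist p.1 p.2 :> R)%R.
  have : \forall n \near \oo, (\bigcap_(p in [set` (P `*` P)%fset])
      [set n | p.1 != p.2 -> (n.+1%:R^-1 < mdist p.1 p.2 :> R)%R]) n.
    apply: filter_bigI => -[x z] _ /=.
    have [->|xz] := eqVneq x z; first by exists 0%N => // n _ /=; rewrite ?eqxx.
    have d0 : (0 < mdist x z)%R by rewrite mdist_gt0.
    exists (Num.truncn (mdist x z)^-1) => // n /= dn _.
    rewrite -[ltRHS]invrK ltf_pV2 ?posrE ?invr_gt0//.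
    by apply: (lt_le_trans (truncnS_gt _)); rewrite ler_nat ltnS.
  by apply: filterS => n h p pP; exact: h.
near=> n.
have /choice[k kP] x : exists k, x \in P -> s n k x.
  have [xP|_] := boolP (x \in P); last by exists 0%N.
  by have [k sk] := sP n x xP; exists k.
have kinj : {in P &, injective k}.
  move=> x z xP zP kxz; apply/eqP; apply: contrapT => /negP xz.
  have : (n.+1%:R^-1 < mdist x z)%R.
    have h : (forall p, p \in (P `*` P)%fset ->
      p.1 != p.2 -> (n.+1%:R^-1 < mdist p.1 p.2 :> R)%R) by near: n.
    by apply: (h (x, z)) => //; rewrite in_fsetM/= xP.
  rewrite ltNge -lee_fin => /negP; apply.
  apply: le_trans (ds n (k x)); apply: mdist_le_diam; first exact: kP.
  by rewrite kxz; exact: kP.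
pose F := [fset k x | x in P]%fset.
have -> : #|` P| = #|` F| by rewrite card_in_imfset.
apply: (@le_trans _ _ (\sum_(j <- F) (\1_(f @` s n j) y)%:E)); last first.
  by apply: lee_sum_fset_lim.
rewrite -fset_sum1 big_seq [leRHS]big_seq; apply: lee_sum => j /imfsetP[/= x xP ->].
by rewrite indicE mem_set//=; exists x; [exact: kP|exact: fP].
Unshelve. all: by end_near. Qed.

End multiplicity_covers.

(** * The integral of the multiplicity function as a measure *)

(** Countable Borel partitions of a separable space with mesh tending to 0. *)
Lemma fine_cells {R : realType} {X : completeMetricType R} : separable_space X ->
  exists Q : nat -> nat -> set X, [/\ forall n k, borel_set (Q n k),
    forall n, trivIset setT (Q n), forall n, \bigcup_k Q n k = setT &
    forall n k, diam (Q n k) <= (n.+1%:R^-1)%:E].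
Proof.
move=> /separable_dense_seq[q qP].
pose r n : R := (n.+1%:R^-1 / 2)%R.
have r0 n : (0 < r n)%R by rewrite divr_gt0.
exists (fun n => seqDU (fun k => ball (q k) (r n))); split.
- move=> n k; apply: borel_setD; first exact: ball_borel.
  elim: k => [|k IH]; first by rewrite big_ord0; exact: borel_set0.
  by rewrite big_ord_recr/=; apply: borel_setU => //; exact: ball_borel.
- by move=> n; exact: trivIset_seqDU.
- move=> n; rewrite -seqDU_bigcup_eq; apply/seteqP; split=> // x _.
  have [k qx] := qP x _ (r0 n).
  by exists k => //; rewrite ballEmdist.
- move=> n k; apply: (@le_trans _ _ (diam (ball (q k) (r n)))).
    by apply: le_diam; exact: subDsetl.
  by apply: le_trans (diam_ball _ _) _; rewrite // lee_fin /r -splitr.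
Qed.

Section limn_einf_bounds.
Context {R : realType}.
Implicit Types (u : (\bar R)^nat) (c : \bar R).

Lemma limn_einf_ge u c : (\forall n \near \oo, c <= u n) -> c <= limn_einf u.
Proof.
move=> [N _ Nc]; rewrite limn_einf_lim; apply: lime_ge; first exact: is_cvg_einfs.
exists N => // n /= Nn; apply: le_ereal_inf_tmp => _ [k /= nk <-].
by apply: Nc; exact: leq_trans nk.
Qed.

Lemma limn_einf_le u c : (forall n, u n <= c) -> limn_einf u <= c.
Proof.
move=> uc; rewrite limn_einf_lim; apply: lime_le; first exact: is_cvg_einfs.
exists 0%N => // n _; apply: le_trans (uc n); apply: ereal_inf_lbound.
by exists n => /=.
Qed.

Lemma measurable_fun_limn_einf d (T : measurableType d) (D : set T)
    (g : (T -> \bar R)^nat) : (forall n, measurable_fun D (g n)) ->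
  measurable_fun D (fun x => limn_einf (g ^~ x)).
Proof.
move=> mg.
rewrite (_ : (fun x => _) = fun x => - limn_esup ((fun n x => - g n x) ^~ x)).
  apply: measurableT_comp => //.
  by apply: measurable_fun_limn_esup => n; exact: measurableT_comp.
apply/funext => x; rewrite -limn_einfN; congr limn_einf.
by apply/funext => n /=; rewrite oppeK.
Qed.

End limn_einf_bounds.

Section pullback_image.
Context {R : realType} {X Y : metricType R}.
Variables (E : set X) (f : X -> Y) (nu : {outer_measure set Y -> \bar R}).

Lemma image_le_cover (A : set X) (s : nat -> set X) : A `<=` \bigcup_k s k ->
  nu (f @` A) <= \sum_(k <oo) nu (f @` s k).
Proof.
move=> As; apply: (@le_trans _ _ (nu (f @` \bigcup_k s k))).
  by apply: le_outer_measure; exact: image_subset.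
rewrite image_bigcup; exact: outer_measure_sigma_subadditive.
Qed.

(** Covers that are almost optimal for the pull-back measure, as sequences. *)
Lemma pullback_cover (A : set X) (delta : R) (c : \bar R) :
  (0 < delta)%R -> pullback_measure E f nu A < c ->
  exists s : nat -> set X, [/\ forall k, borel_set (s k), forall k, s k `<=` E,
    forall k, diam (s k) <= delta%:E, A `&` E `<=` \bigcup_k s k &
    \sum_(k <oo) nu (f @` s k) < c].
Proof.
move=> d0 Ac.
have : pullback_premeasure E f nu delta (A `&` E) < c.
  by apply: le_lt_trans Ac; apply: ereal_sup_ubound; exists delta.
move=> /ereal_inf_lt[_ [G [cG GP AG] <-]].
have [s [sG Gs _ Ga]] := @countable_family_seq R _ _ cG.
rewrite (Ga (fun S => nu (f @` S))) => [Gc||]; last 2 first.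
  by move=> S; exact: outer_measure_ge0.
  by rewrite image_set0 outer_measure0.
exists s; split => //; last by rewrite -Gs.
- by move=> k; have [/GP[]|->] := sG k => //; exact: borel_set0.
- by move=> k; have [/GP[]|->] := sG k.
- move=> k; have [/GP[]|->] := sG k => //.
  by apply: diam_le => //; exact: ltW.
Qed.

Lemma image_le_pullback (A : set X) :
  nu (f @` (A `&` E)) <= pullback_measure E f nu A.
Proof.
rewrite leNgt; apply/negP => /(pullback_cover ltr01)[s [_ _ _ As]].
by rewrite ltNge image_le_cover.
Qed.

End pullback_image.

Section multiplicity_measure.
Context {R : realType} {X : completeMetricType R} {Y : pMetricType R}.
Variables (mu : {outer_measure set X -> \bar R}).
Variables (nu : {outer_measure set Y -> \bar R}).
Variables (E : set X) (f : X -> Y).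
Hypothesis sX : separable_space X.
Hypothesis rmu : borel_regular mu.
Hypothesis fmu : finite_on_bounded mu.
Hypothesis bnu : borel_measure nu.
Hypothesis cE : closed E.
Hypothesis cf : {within E, continuous f}.
Hypothesis acf : abs_continuous (pullback_measure E f nu) mu.

Let bmu : borel_measure mu := proj1 rmu.

Lemma null_image (N : set X) : mu N = 0 -> nu (f @` (N `&` E)) = 0.
Proof.
move=> /acf N0; apply/eqP; rewrite eq_le outer_measure_ge0 andbT -N0.
exact: image_le_pullback.
Qed.

Lemma measurable_E : mu.-cara.-measurable E.
Proof. by apply: bmu; exact: borel_closed. Qed.

(** The null part of the compact exhaustion is harmless as its image is null. *)
Lemma measurable_image (A : set X) : mu.-cara.-measurable A ->
  nu.-cara.-measurable (f @` (A `&` E)).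
Proof.
move=> mA; have mAE : mu.-cara.-measurable (A `&` E).
  by apply: measurableI => //; exact: measurable_E.
have [K [cK KA A0]] := compact_exhaustion rmu fmu sX mAE.
have -> : f @` (A `&` E) = \bigcup_i (f @` K i) `|`
    f @` (((A `&` E) `\` \bigcup_i K i) `&` E).
  rewrite -image_bigcup -image_setU; congr (f @` _).
  apply/seteqP; split=> [x AEx|x [[i _ /KA]|[[[]]]]//].
  by have [Kx|Kx] := pselect ((\bigcup_i K i) x); [left|right; case: AEx].
apply: measurableU; last by apply: caratheodory_null; exact: null_image.
apply: countable_bigcupT_measurable => // i; apply: bnu; apply: borel_closed.
apply: compact_closed; first exact: metric_hausdorff.
apply: continuous_compact => //; apply: continuous_subspaceW cf.
by apply: subset_trans (KA i) _; exact: subIsetr.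
Qed.

Lemma measurable_indic_image (A : set X) : mu.-cara.-measurable A ->
  A `<=` E ->
  measurable_fun setT
    ((fun y => (\1_(f @` A) y)%:E) : caratheodory_type nu -> \bar R).
Proof.
move=> mA AE; apply/measurable_EFinP; apply: measurable_indic.
by have := measurable_image mA; rewrite setIidl.
Qed.

Lemma measurable_multiplicity (A : set X) : mu.-cara.-measurable A ->
  A `<=` E ->
  measurable_fun setT (multiplicity f A : caratheodory_type nu -> \bar R).
Proof.
move=> mA AE; have [Q [bQ tQ cQ dQ]] := fine_cells sX.
pose u n y : \bar R := \sum_(k <oo) (\1_(f @` (A `&` Q n k)) y)%:E.
(* u n y counts the cells of mesh 1/(n+1) whose trace on A meets the fibre. *)
have -> : multiplicity f A = (fun y => esups (u ^~ y) 0%N).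
  apply/funext => y; apply/eqP; rewrite eq_le; apply/andP; split.
    apply: counting_le => P PA.
    have [] := @card_le_fine_cover _ _ _ P (fun n k => A `&` Q n k) f y.
    - by move=> x xP; have [] := PA x xP.
    - by move=> n k; apply: le_trans (dQ n k); apply: le_diam; exact: subIsetr.
    - move=> n x xP; have [Ax _] := PA x xP.
      have [k _ Qx] : (\bigcup_k Q n k) x by rewrite cQ.
      by exists k.
    move=> n _ /(_ n (leqnn n)) nP; apply: (le_trans nP).
    by apply: ereal_sup_ubound; exists n.
  apply: ge_ereal_sup => _ [n _ <-]; rewrite /u.
  apply: (@le_trans _ _ (\sum_(k <oo) multiplicity f (A `&` Q n k) y)).
    by apply: lee_nneseries => // k _; exact: multiplicity_ge_indic.
  rewrite -multiplicity_bigcup; last exact: trivIset_setIl.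
  by apply: le_multiplicity; rewrite -setI_bigcupr; exact: subIsetl.
apply: measurable_fun_esups => n.
apply: ge0_emeasurable_sum => // k _.
apply: measurable_indic_image; last by move=> x [/AE].
by apply: measurableI => //; exact: bmu.
Qed.

(** The set function m, defined on all sets; it is a measure on the sigma-algebra
    of the mu-measurable ones. *)
Definition multiplicity_measure (A : set (caratheodory_type mu)) : \bar R :=
  \int[nu : set (caratheodory_type nu) -> \bar R]_y multiplicity f (A `&` E) y.

Let measurable_multE (A : set X) : mu.-cara.-measurable A ->
  measurable_fun setT (multiplicity f (A `&` E) : caratheodory_type nu -> \bar R).
Proof.
move=> mA; apply: measurable_multiplicity; last exact: subIsetr.
by apply: measurableI => //; exact: measurable_E.
Qed.

Let mult0 : multiplicity_measure set0 = 0.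
Proof.
rewrite /multiplicity_measure set0I; apply: integral0_eq => y _.
by rewrite /multiplicity set0I counting_set0.
Qed.

Let mult_ge0 A : 0 <= multiplicity_measure A.
Proof. by apply: integral_ge0 => y _; exact: counting_nonneg. Qed.

Let mult_sigma_additive : semi_sigma_additive multiplicity_measure.
Proof.
move=> F mF tF mUF.
have -> : multiplicity_measure (\bigcup_n F n) =
    \sum_(n <oo) multiplicity_measure (F n).
  rewrite /multiplicity_measure -integral_nneseries//; last 2 first.
  - by move=> n; exact: measurable_multE.
  - by move=> n y _; exact: counting_nonneg.
  apply: eq_integral => y _; rewrite setI_bigcupl multiplicity_bigcup//.
  exact: trivIset_setIr.
by apply: is_cvg_nneseries => n _ _; exact: mult_ge0.
Qed.

HB.instance Definition _ := isMeasure.Build _ _ _ multiplicity_measure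
  mult0 mult_ge0 mult_sigma_additive.

Lemma image_le_multiplicity_measure (A : set X) : mu.-cara.-measurable A ->
  nu (f @` (A `&` E)) <= multiplicity_measure A.
Proof.
move=> mA; rewrite -[X in nu X]setIT -integral_indic//;
  last exact: measurable_image.
apply: ge0_le_integral => //.
- apply: measurable_indic_image; last exact: subIsetr.
  by apply: measurableI => //; exact: measurable_E.
- exact: measurable_multE.
- by move=> y _; exact: multiplicity_ge_indic.
Qed.

Lemma multiplicity_measure_inj (A : set X) : mu.-cara.-measurable A ->
  {in A `&` E &, injective f} -> multiplicity_measure A = nu (f @` (A `&` E)).
Proof.
move=> mA finj; rewrite -[X in nu X]setIT -integral_indic//;
  last exact: measurable_image.
by apply: eq_integral => y _; exact: multiplicity_inj.
Qed.

Lemma multiplicity_measure_null (A : set X) : mu.-cara.-measurable A ->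
  nu (f @` (A `&` E)) = 0 -> multiplicity_measure A = 0.
Proof.
move=> mA fA0.
rewrite /multiplicity_measure (ge0_negligible_integral _ _ _ _ fA0)//.
- rewrite integral0_eq// => y [_ yA]; rewrite /multiplicity.
  rewrite (_ : _ `&` _ = set0) ?counting_set0// -subset0 => x [Ax fx].
  by apply: yA; exists x.
- exact: measurable_image.
- exact: measurable_multE.
- by move=> y _; exact: counting_nonneg.
Qed.

Lemma multiplicity_measure_ac (N : set X) : mu N = 0 -> multiplicity_measure N = 0.
Proof.
move=> N0; apply: multiplicity_measure_null; last exact: null_image.
exact: caratheodory_null.
Qed.

(** Fatou's lemma, applied to the functions that count the images of the sets of
    almost optimal covers of mesh 1/(n+1). *)
Lemma multiplicity_measure_le_pullback (A : set X) : mu.-cara.-measurable A ->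
  multiplicity_measure A <= pullback_measure E f nu A.
Proof.
move=> mA; apply/lee_addgt0Pr => e e0.
have [->|pfin] := eqVneq (pullback_measure E f nu A) +oo.
  by rewrite addye// leey.
have plt : pullback_measure E f nu A < pullback_measure E f nu A + e%:E.
  rewrite lteDl ?lte_fin// fin_numE pfin andbT gt_eqF//.
  by apply: lt_le_trans (image_le_pullback _ _ _ _); rewrite -/(_ < _);
     apply: lt_le_trans (outer_measure_ge0 nu _).
have d0 n : (0 < n.+1%:R^-1 :> R)%R by rewrite invr_gt0.
have /choice[s sP] n := pullback_cover (d0 n) plt.
pose u n y : \bar R := \sum_(k <oo) (\1_(f @` s n k) y)%:E.
have ms n k : mu.-cara.-measurable (s n k).
  by apply: bmu; have [bs _ _ _ _] := sP n; exact: bs.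
have sE n k : s n k `<=` E by have [_ sE _ _ _] := sP n; exact: sE.
have mu_ n : measurable_fun setT (u n : caratheodory_type nu -> \bar R).
  apply: ge0_emeasurable_sum => // k _.
  exact: measurable_indic_image.
apply: (@le_trans _ _ (\int[nu : set (caratheodory_type nu) -> \bar R]_y
    limn_einf (u ^~ y))).
  apply: ge0_le_integral => //.
  - by move=> y _; exact: counting_nonneg.
  - exact: measurable_multE.
  - exact: measurable_fun_limn_einf.
  move=> y _; apply: counting_le => P PA; apply: limn_einf_ge.
  apply: card_le_fine_cover.
  - by move=> x xP; have [] := PA x xP.
  - by move=> n k; have [_ _ + _ _] := sP n; apply.
  - move=> n x xP; have [Ax _] := PA x xP.
    have [_ _ _ As _] := sP n; have [k _ sx] := As _ Ax.
    by exists k.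
apply: (le_trans (fatou _ _ _ _)) => //.
  by move=> n y _; apply: nneseries_ge0 => k _ _.
apply: limn_einf_le => n; rewrite /u integral_nneseries//; last first.
  by move=> k; exact: measurable_indic_image.
have [_ _ _ _ /ltW] := sP n; apply: le_trans.
apply: lee_nneseries => [k _ _|k _]; first exact: integral_ge0.
rewrite integral_indic ?setIT//.
by have := measurable_image (ms n k); rewrite setIidl.
Qed.

(** The measure m as a bundled object, which no longer carries the hypotheses
    under which it is a measure. *)
Lemma multiplicity_measureP :
  exists m : {measure set (caratheodory_type mu) -> \bar R},
    forall A, m A = multiplicity_measure A.
Proof. by exists multiplicity_measure. Qed.

End multiplicity_measure.

(** * Densities, and upper limits along a covering relation *)

Section sigma_finite_copy.
Context {d} {T : measurableType d} {R : realType}.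
Variable mu : {measure set T -> \bar R}.
Hypothesis sf : sigma_finite setT mu.

(** The measure mu, tagged with a proof of sigma-finiteness, so that it can be
    equipped with the structure of a sigma-finite measure. *)
Definition sigma_finite_copy (_ : sigma_finite setT mu) : set T -> \bar R := mu.

HB.instance Definition _ := Measure.on (sigma_finite_copy sf).
HB.instance Definition _ :=
  Measure_isSigmaFinite.Build _ _ _ (sigma_finite_copy sf) sf.

End sigma_finite_copy.

Section sigma_finite_density.
Context {d} {T : measurableType d} {R : realType}.
Variables mu m : {measure set T -> \bar R}.

(** Radon-Nikodym theorem for measures mu and m that are both finite on the sets
    of a common countable cover: the densities of the restrictions of m to the pieces
    of a partition are added. *)
Lemma sigma_finite_density (B : nat -> set T) :
  (forall n, measurable (B n)) -> \bigcup_n B n = setT ->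
  (forall n, mu (B n) < +oo) -> (forall n, m (B n) < +oo) ->
  (forall N, measurable N -> mu N = 0 -> m N = 0) ->
  exists g : T -> \bar R, [/\ forall x, 0 <= g x, measurable_fun setT g &
    forall A, measurable A -> m A = \int[mu]_(x in A) g x].
Proof.
move=> mB cB muB mBoo ac.
have sf : sigma_finite setT mu by exists B.
(* A partition into sets of finite m-measure. *)
pose D := seqDU B.
have mD n : measurable (D n).
  by apply: measurableD => //; exact: bigsetU_measurable.
have mDoo n : m (D n) < +oo.
  by apply: le_lt_trans (mBoo n); apply: le_measure; rewrite ?inE//; exact: subDsetl.
have /choice[g gP] n : exists g : T -> \bar R, [/\ forall x, 0 <= g x,
    measurable_fun setT g &
    forall A, measurable A -> m (A `&` D n) = \int[mu]_(x in A) g x].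
  have [|g [g0 _ ig gE]] := @radon_nikodym_sigma_finite _ _ _ (sigma_finite_copy sf)
      (mfrestr (mD n) (mDoo n)).
    apply/null_content_dominatesP => A mA A0; apply: ac; first exact: measurableI.
    apply/eqP; rewrite eq_le measure_ge0 andbT -[leRHS]A0.
    by apply: le_measure; rewrite ?inE//; exact: measurableI.
  exists g; split => //; first by have /integrableP[] := ig.
exists (fun x => \sum_(n <oo) g n x); split.
- by move=> x; apply: nneseries_ge0 => n _ _; have [+ _ _] := gP n; apply.
- apply: ge0_emeasurable_sum => [n x _ _|n _]; first by have [+ _ _] := gP n; apply.
  by have [_ + _] := gP n.
move=> A mA; rewrite integral_nneseries//; last 2 first.
- by move=> n; have [_ + _] := gP n; exact: measurable_funTS.
- by move=> n x _; have [+ _ _] := gP n; apply.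
rewrite -[in LHS](setIT A) -cB seqDU_bigcup_eq setI_bigcupr.
rewrite measure_bigcup//=; last 2 first.
- by move=> n _; exact: measurableI.
- by apply: trivIset_setIl; exact: trivIset_seqDU.
rewrite (eq_eseriesl (Q := xpredT)) => [|n]; last by rewrite in_setT.
apply: eq_eseriesr => n _.
by have [_ _ ->] := gP n.
Qed.

End sigma_finite_density.

Section vitali_limsup_lemmas.
Context {R : realType} {X : metricType R}.
Variables (V : set (X * set X)) (dom : set (set X)) (phi : set X -> \bar R).

Let h x (e : R) := ereal_sup
  [set phi S | S in [set S | [/\ V (x, S), dom S & diam S < e%:E]]].

(* The suprema are nondecreasing in e, hence their limit at 0+ is an infimum. *)
Let vitali_limsupE x :
  vitali_limsup V dom phi x = ereal_inf (h x @` [set e | (0 < e)%R]).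
Proof.
have hE : h x @ (0:R)^'+ -->
    ereal_inf (h x @` [set` Interval (BRight 0%R) (BInfty R false)]).
  apply: nondecreasing_at_right_cvge => // a b _ _ ab.
  apply: le_ereal_sup => _ [S [VS dS Sa] <-]; exists S => //; split => //.
  by apply: lt_le_trans Sa _; rewrite lee_fin.
rewrite /vitali_limsup (cvg_lim _ hE)//; congr (ereal_inf (_ @` _)).
by apply/seteqP; split=> a /=; rewrite in_itv/= andbT.
Qed.

Lemma vitali_limsup_lt x (s : \bar R) : vitali_limsup V dom phi x < s ->
  exists2 e : R, (0 < e)%R &
    forall S, V (x, S) -> dom S -> diam S < e%:E -> phi S < s.
Proof.
rewrite vitali_limsupE => /ereal_inf_lt[_ [e /= e0 <-] hs].
exists e => // S VS dS Se; apply: le_lt_trans hs.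
by apply: ereal_sup_ubound; exists S.
Qed.

Lemma vitali_limsup_gt x (t : \bar R) : t < vitali_limsup V dom phi x ->
  forall e : R, (0 < e)%R ->
    exists S, [/\ V (x, S), dom S, diam S < e%:E & t < phi S].
Proof.
rewrite vitali_limsupE => tV e e0.
have /ereal_sup_gt[_ [S [VS dS Se] <-] tS] : t < h x e.
  by apply: lt_le_trans tV _; apply: ereal_inf_lbound; exists e.
by exists S.
Qed.

End vitali_limsup_lemmas.

Section ereal_comparison.
Context {R : realType}.

(** An inequality t z <= s z with s < t forces z = 0 when z is finite; the
    error e comes from outer regularity. *)
Lemma null_of_gap (z : \bar R) (s t : R) : 0 <= z -> z < +oo -> (s < t)%R ->
  (forall e : R, (0 < e)%R -> t%:E * z <= s%:E * z + e%:E) -> z = 0.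
Proof.
case: z => [z| |]//; rewrite lee_fin => z0 _ st h; congr EFin.
apply/eqP; rewrite eq_le z0 andbT leNgt; apply/negP => z1.
have zp : (0 < (t - s) * z / 2)%R by rewrite divr_gt0// mulr_gt0// subr_gt0.
by have := h _ zp; rewrite -!EFinM -EFinD lee_fin; nra.
Qed.

(** The convention r / 0 = +oo for r > 0 makes this hold for b = 0 too, as 0 / 0
    is excluded. *)
Lemma quotient_lt (a b : \bar R) (s : R) : 0 <= a -> 0 <= b -> b < +oo ->
  ~ (a = 0 /\ b = 0) -> a / b < s%:E -> a <= s%:E * b.
Proof.
case: b => [b| |]//; rewrite lee_fin => a0 b0 _ ab.
have [b00|bn0] := eqVneq b 0%R.
  have ap : 0 < a.
    rewrite lt_neqAle a0 andbT; apply/negP => /eqP a00.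
    by apply: ab; rewrite b00 -a00.
  by rewrite b00 inve0 gt0_muley// ltNge leey.
have bp : (0 < b)%R by rewrite lt_neqAle eq_sym bn0.
rewrite inver (negbTE bn0); case: a a0 {ab} => [a| |]//.
  by rewrite lee_fin => a0; rewrite -!EFinM lte_fin lee_fin ltr_pdivrMr// => /ltW.
by rewrite gt0_mulye ?lte_fin ?invr_gt0// ltNge leey.
Qed.

Lemma quotient_gt (a b : \bar R) (t : R) : 0 <= a -> 0 <= b -> b < +oo ->
  t%:E < a / b -> t%:E * b <= a.
Proof.
case: b => [b| |]//; rewrite lee_fin => a0 b0 _.
have [->|bn0] := eqVneq b 0%R; first by move=> _; rewrite mule0.
have bp : (0 < b)%R by rewrite lt_neqAle eq_sym bn0.
rewrite inver (negbTE bn0); case: a a0 => [a _| _ _|//]; last by rewrite leey.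
by rewrite -!EFinM lte_fin lee_fin ltr_pdivlMr// => /ltW.
Qed.

Lemma ereal_rat_between (a b : \bar R) : 0 <= a -> a < b ->
  exists p q : rat, [/\ (0 < ratr p :> R)%R, (ratr p < ratr q :> R)%R,
    a < (ratr p)%:E & (ratr q)%:E < b].
Proof.
case: a => [a| |]// + ab; last by rewrite ltNge leey in ab.
rewrite lee_fin => a0.
have [c ac cb] : exists2 c : R, (a < c)%R & c%:E <= b.
  case: b ab => [b| |]//; first by exists b.
  by exists (a + 1)%R; rewrite ?leey// ltrDl.
have [q] := rat_in_itvoo ac; rewrite in_itv/= => /andP[aq qc].
have [p] := rat_in_itvoo aq; rewrite in_itv/= => /andP[ap pq].
exists p, q; split => //; rewrite ?lte_fin//; first exact: le_lt_trans ap.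
by apply: lt_le_trans cb; rewrite lte_fin.
Qed.

End ereal_comparison.

(** * Comparison of the Jacobian with the density *)

Section differentiation.
Context {R : realType} {X Y : pMetricType R}.
Variables (mu : {outer_measure set X -> \bar R}).
Variables (nu : {outer_measure set Y -> \bar R}).
Variables (V : set (X * set X)) (E : set X) (f : X -> Y).
Hypothesis rmu : borel_regular mu.
Hypothesis fmu : finite_on_bounded mu.
Hypothesis vV : vitali_relation mu V.
Hypothesis nu_null : forall N : set X, mu N = 0 -> nu (f @` (N `&` E)) = 0.
Variable m : {measure set (caratheodory_type mu) -> \bar R}.
Hypothesis nu_le_m : forall A : set X, mu.-cara.-measurable A ->
  nu (f @` (A `&` E)) <= m A.
Hypothesis m_ac : forall N : set X, mu N = 0 -> m N = 0.
Hypothesis m_ball : forall x r, m (ball x r) < +oo.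

Let bmu : borel_measure mu := proj1 rmu.
Local Notation J := (vitali_jacobian E f nu mu V).

(** The covering property of a Vitali relation, with the disjoint family
    presented as a sequence that may contain empty terms. *)
Lemma vitali_cover (C : set (X * set X)) (Z : set X) : C `<=` V ->
  (forall x, Z x -> fine_at C x) ->
  exists s : nat -> set X, [/\ forall n, borel_set (s n), trivIset setT s,
    forall n, (exists2 x, Z x & C (x, s n)) \/ s n = set0 &
    mu (Z `\` \bigcup_n s n) = 0].
Proof.
have [covV borV _ vit] := vV.
move=> CV fC; have [G [GC cG tG ZG]] := vit C Z CV fC.
have [s [sG Gs ts _]] := @countable_family_seq R _ _ cG.
exists s; split; last by rewrite -Gs.
- move=> n; have [/GC[x _ /CV Vx]|->] := sG n; last exact: borel_set0.
  by apply: borV; exists x.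
- exact: ts.
- by move=> n; have [/GC[x Zx Cx]|->] := sG n; [left; exists x|right].
Qed.

Lemma small_set_finite (S : set X) (e : R) : diam S < e%:E -> mu S < +oo.
Proof. by move=> Se; apply: fmu; apply: lt_trans Se _; rewrite ltry. Qed.

(** If the Jacobian exceeds t on Z, then m has at least t times the measure of
    Z in every open set containing Z. Injectivity is not needed, because
    nu(f(S & E)) <= m(S) always. *)
Lemma jacobian_gt_estimate (Z W : set X) (t : R) : (0 <= t)%R ->
  open W -> Z `<=` W -> (forall x, Z x -> t%:E < J x) -> t%:E * mu Z <= m W.
Proof.
move=> t0 oW ZW tJ.
pose C := [set p | [/\ V p, p.2 `<=` W & t%:E * mu p.2 <= nu (f @` (p.2 `&` E))]].
have [||s [bs ts sC Zs]] := @vitali_cover C Z; first by move=> p [].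
  move=> x Zx; apply/fine_atP => e e0.
  move: oW; rewrite openE => /(_ _ (ZW _ Zx))/nbhs_ballP[a /= a0 aW].
  have ea0 : (0 < Num.min e a)%R by rewrite lt_min e0.
  have [S [VS _ Se tS]] := vitali_limsup_gt (tJ _ Zx) ea0.
  have [covV _ _ _] := vV; have Sx := covV _ _ VS.
  exists S; last by apply: lt_le_trans Se _; rewrite lee_fin ge_min lexx.
  split => //=.
    apply: subset_trans aW; apply: subset_ball => //.
    by apply: lt_le_trans Se _; rewrite lee_fin ge_min lexx orbT.
  have muS := small_set_finite Se.
  exact: (quotient_gt (outer_measure_ge0 _ _) (outer_measure_ge0 _ _) muS tS).
have ms n : mu.-cara.-measurable (s n) by exact: bmu.
have mUs : mu.-cara.-measurable (\bigcup_n s n) by exact: bigcupT_measurable.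
have sW n : s n `<=` W by have [[x _ []]|->] := sC n.
apply: (@le_trans _ _ (\sum_(n <oo) m (s n))); last first.
  rewrite -(eq_eseriesl (P := [pred n | n \in [set: nat]])); last first.
    by move=> n /=; rewrite in_setT.
  rewrite -measure_bigcup//; apply: le_measure; rewrite ?inE//.
    by apply: bmu; exact: borel_open.
  by move=> x [n _]; exact: sW.
apply: (@le_trans _ _ (t%:E * \sum_(n <oo) mu (s n))).
  apply: lee_wpmul2l; first by rewrite lee_fin.
  apply: (outer_measure_le_series _ Zs) => x Zx.
  by have [?|?] := pselect ((\bigcup_n s n) x); [left|right].
rewrite -nneseriesZl//; apply: lee_nneseries => [n _ _|n _].
  by apply: mule_ge0; rewrite ?lee_fin.
apply: le_trans (nu_le_m (ms n)).
by have [[x _ []]|->] := sC n; rewrite // outer_measure0 mule0.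
Qed.

(** If the Jacobian is less than s on Z, then the image of Z, and even that of a
    measurable set containing Z, is small. *)
Lemma jacobian_lt_estimate (Z W : set X) (s : R) : (0 < s)%R ->
  open W -> Z `<=` W -> (forall x, Z x -> J x < s%:E) ->
  exists Z', [/\ mu.-cara.-measurable Z', Z `<=` Z' &
    nu (f @` (Z' `&` E)) <= s%:E * mu W].
Proof.
move=> s0 oW ZW sJ.
pose C := [set p | [/\ V p, p.2 `<=` W & nu (f @` (p.2 `&` E)) <= s%:E * mu p.2]].
have [||S [bS tS SC ZS]] := @vitali_cover C Z; first by move=> p [].
  move=> x Zx; apply/fine_atP => e e0.
  move: oW; rewrite openE => /(_ _ (ZW _ Zx))/nbhs_ballP[a /= a0 aW].
  have [b b0 bS] := vitali_limsup_lt (sJ _ Zx).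
  have [covV _ fV _] := vV.
  have ea0 : (0 < Num.min e (Num.min a b))%R by rewrite !lt_min e0 a0.
  have [S VS Se] := (fine_atP V x).2 (fV x) _ ea0.
  have Sx := covV _ _ VS.
  exists S; last by apply: lt_le_trans Se _; rewrite lee_fin ge_min lexx.
  split => //=.
    apply: subset_trans aW; apply: subset_ball => //.
    by apply: lt_le_trans Se _; rewrite lee_fin !ge_min lexx orbT.
  have [[-> ->]|d0] := pselect (nu (f @` (S `&` E)) = 0 /\ mu S = 0).
    by rewrite mule0.
  apply: (quotient_lt _ _ (small_set_finite Se) d0) => //.
  by apply: bS => //; apply: lt_le_trans Se _; rewrite lee_fin !ge_min lexx !orbT.
have mS n : mu.-cara.-measurable (S n) by exact: bmu.
have mUS : mu.-cara.-measurable (\bigcup_n S n) by exact: bigcupT_measurable.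
have SW n : S n `<=` W by have [[x _ []]|->] := SC n.
(* The part of Z that is not covered is null, hence measurable, and has a null
   image. *)
exists (\bigcup_n S n `|` (Z `\` \bigcup_n S n)); split.
- by apply: measurableU => //; exact: caratheodory_null.
- by move=> x Zx; have [?|?] := pselect ((\bigcup_n S n) x); [left|right].
apply: (@le_trans _ _ (\sum_(n <oo) s%:E * mu (S n))).
  apply: (@le_trans _ _ (\sum_(n <oo) nu (f @` (S n `&` E)))).
    apply: (outer_measure_le_series _ (nu_null ZS)).
    by rewrite setIUl image_setU setI_bigcupl image_bigcup.
  apply: lee_nneseries => [n _ _|n _]; first exact: outer_measure_ge0.
  have [[x _ []]|->] := SC n; first by [].
  by rewrite set0I image_set0 !outer_measure0 mule0.
rewrite nneseriesZl//; apply: lee_wpmul2l; first by rewrite lee_fin ltW.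
rewrite -(eq_eseriesl (P := [pred n | n \in [set: nat]])); last first.
  by move=> n /=; rewrite in_setT.
rewrite -(measure_bigcup (mu : {measure set (caratheodory_type mu) -> \bar R}))//.
by apply: le_outer_measure => x [n _]; exact: SW.
Qed.

(** The upper limit is negative (it is then -oo) only where the quotient is 0 / 0
    for all small sets, which happens on a null set. *)
Lemma jacobian_ge0_ae : mu [set x | J x < 0] = 0.
Proof.
pose C := [set p | V p /\ mu p.2 = 0].
have [||S [bS tS SC ZS]] := @vitali_cover C [set x | J x < 0]; first by move=> p [].
  move=> x /= Zx; apply/fine_atP => e e0.
  have [b b0 bS] := vitali_limsup_lt Zx.
  have [_ _ fV _] := vV.
  have ea0 : (0 < Num.min e b)%R by rewrite !lt_min e0.
  have [S VS Se] := (fine_atP V x).2 (fV x) _ ea0.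
  exists S; last by apply: lt_le_trans Se _; rewrite lee_fin ge_min lexx.
  split => //=; apply: contrapT => S0.
  have : nu (f @` (S `&` E)) / mu S < 0.
    apply: bS => //; first by move=> [].
    by apply: lt_le_trans Se _; rewrite lee_fin ge_min lexx orbT.
  by rewrite ltNge mule_ge0// inve_ge0.
apply: (outer_measure_null_le (B := \bigcup_n S n `|`
  ([set x | J x < 0] `\` \bigcup_n S n))).
  by move=> x Zx; have [?|?] := pselect ((\bigcup_n S n) x); [left|right].
apply/eqP; rewrite eq_le outer_measure_ge0 andbT.
apply: (le_trans (outer_measureU2 _ _ _)); rewrite ZS adde0.
rewrite outer_measure_null_bigcup// => n.
by have [[x _ [_]]|->] := SC n; rewrite ?outer_measure0.
Qed.

Section density.
Variable g : X -> \bar R.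
Hypothesis g_ge0 : forall x, 0 <= g x.
Hypothesis mg : measurable_fun setT (g : caratheodory_type mu -> \bar R).
Hypothesis m_density : forall A : set X, mu.-cara.-measurable A ->
  m A = \int[mu : set (caratheodory_type mu) -> \bar R]_(x in A) g x.

(** The set Z, here and in [jacobian_lt_density_null], need not be measurable:
    the measurability of the Jacobian is only known afterwards. *)
Lemma jacobian_gt_density_null (Z : set X) (x0 : X) (r s t : R) :
  (0 <= s)%R -> (s < t)%R -> Z `<=` ball x0 r ->
  (forall x, Z x -> g x < s%:E) -> (forall x, Z x -> t%:E < J x) -> mu Z = 0.
Proof.
move=> s0 st Zr gs tJ.
have mb : mu.-cara.-measurable (ball x0 r) by apply: bmu; exact: ball_borel.
have Zoo : mu Z < +oo.
  apply: (@le_lt_trans _ _ (mu (ball x0 r))); first exact: le_outer_measure.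
  exact: finite_on_ball.
apply: (null_of_gap _ Zoo st) => // e e0.
have [H [bH ZH HZ]] := rmu.2 Z.
pose U := H `&` ball x0 r `&` [set x | g x < s%:E].
have mHb : mu.-cara.-measurable (H `&` ball x0 r).
  by apply: measurableI => //; exact: bmu.
have mU : mu.-cara.-measurable U.
  by apply: emeasurable_fun_infty_o => //; exact: measurable_funTS.
have ZU : Z `<=` U by move=> x Zx; split; [split; [exact: ZH|exact: Zr]|exact: gs].
pose pi := mrestr m mb.
have [|N mN N0|W [oW UW We]] :=
  @open_approx_measure R X mu rmu fmu pi U e _ _ mU e0.
- by rewrite /pi/= /mrestr setTI; exact: m_ball.
- rewrite /pi/= /mrestr; apply: m_ac.
  exact: (outer_measure_null_le (@subIsetl _ _ _)).
have oWb : open (W `&` ball x0 r) by apply: openI => //; exact: metric_ball_open.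
apply: (le_trans (jacobian_gt_estimate _ oWb _ tJ)).
  by apply: ltW; exact: le_lt_trans st.
  by move=> x Zx; split; [exact/UW/ZU|exact: Zr].
apply: (le_trans We); rewrite leeD2r//.
rewrite /pi/= /mrestr setIidl; last by move=> x [[]].
rewrite m_density//.
apply: (@le_trans _ _
  (\int[mu : set (caratheodory_type mu) -> \bar R]_(x in U) (cst s%:E x))).
  apply: ge0_le_integral => //; first exact: measurable_funTS.
  by move=> x [_ /ltW].
rewrite integral_cst//; apply: lee_wpmul2l; first by rewrite lee_fin.
by rewrite -HZ; apply: le_outer_measure => x [[]].
Qed.

(** The set P is one on which m does not exceed the measure of the image, as when
    f is injective on P. *)
Lemma jacobian_lt_density_null (Z P : set X) (x0 : X) (r s t : R) :
  (0 < s)%R -> (s < t)%R -> Z `<=` ball x0 r ->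
  mu.-cara.-measurable P -> Z `<=` P ->
  (forall A, mu.-cara.-measurable A -> A `<=` P -> m A <= nu (f @` (A `&` E))) ->
  (forall x, Z x -> J x < s%:E) -> (forall x, Z x -> t%:E < g x) -> mu Z = 0.
Proof.
move=> s0 st Zr mP ZP mnu sJ tg.
have Zoo : mu Z < +oo.
  apply: (@le_lt_trans _ _ (mu (ball x0 r))); first exact: le_outer_measure.
  exact: finite_on_ball.
apply: (null_of_gap _ Zoo st) => // e e0.
have es0 : (0 < e / s)%R by exact: divr_gt0.
have [W [oW ZW Wr We]] := open_approx_outer rmu fmu Zr es0.
have [Z' [mZ' ZZ' fZ']] := jacobian_lt_estimate s0 oW ZW sJ.
pose U := Z' `&` P `&` [set x | t%:E < g x].
have mZP : mu.-cara.-measurable (Z' `&` P) by exact: measurableI.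
have mU : mu.-cara.-measurable U.
  by apply: emeasurable_fun_o_infty => //; exact: measurable_funTS.
have ZU : Z `<=` U by move=> x Zx; split; [split; [exact: ZZ'|exact: ZP]|exact: tg].
have t0 : (0 <= t)%R by apply: ltW; apply: lt_trans st.
apply: (@le_trans _ _ (t%:E * mu U)).
  by apply: lee_wpmul2l; [rewrite lee_fin|exact: le_outer_measure].
rewrite -(integral_cst (mu : {measure set (caratheodory_type mu) -> \bar R}))//.
apply: (@le_trans _ _ (m U)).
  rewrite m_density//; apply: ge0_le_integral => //.
  - exact: measurable_funTS.
  - by move=> x [_ /ltW].
apply: (le_trans (mnu U mU _)); first by move=> x [[]].
apply: (@le_trans _ _ (nu (f @` (Z' `&` E)))).
  by apply: le_outer_measure; apply: image_subset; apply: setSI => x [[]].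
apply: (le_trans fZ'); apply: (@le_trans _ _ (s%:E * (mu Z + (e / s)%:E))).
  by apply: lee_wpmul2l => //; rewrite lee_fin ltW.
rewrite ge0_muleDr ?lee_fin ?(ltW es0)// -EFinM mulrC divfK//.
by rewrite gt_eqF.
Qed.

(** A statement of the type of Sard's theorem: the image of the set where the
    Jacobian vanishes is null. *)
Lemma jacobian_eq0_image_null (Z : set X) : Z `<=` E -> (forall x, Z x -> J x = 0) ->
  nu (f @` Z) = 0.
Proof.
move=> ZE J0.
apply: (outer_measure_null_le (B := \bigcup_n (f @` (Z `&` ball (point : X) n.+1%:R)))).
  by rewrite -image_bigcup -setI_bigcupr bigcup_ball setIT.
apply: outer_measure_null_bigcup => n; set B := ball _ _.
apply/eqP; rewrite eq_le outer_measure_ge0 andbT.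
have Boo : mu B < +oo by exact: finite_on_ball.
have Bfin : mu B \is a fin_num by rewrite ge0_fin_numE.
apply/lee_addgt0Pr => e e0; rewrite add0e.
(* The summand 1 keeps the denominator positive when mu B = 0. *)
pose b := (fine (mu B) + 1)%R.
have b0 : (0 < b)%R by rewrite ltr_wpDl// fine_ge0.
have eb0 : (0 < e / b)%R by exact: divr_gt0.
have oB : open B by exact: metric_ball_open.
have [||Z' [mZ' ZZ' fZ']] := @jacobian_lt_estimate (Z `&` B) B _ eb0 oB.
- exact: subIsetr.
- by move=> x [/J0 -> _]; rewrite lte_fin.
apply: (@le_trans _ _ (nu (f @` (Z' `&` E)))).
  apply: le_outer_measure; apply: image_subset => x ZBx.
  by split; [exact: ZZ'|apply: ZE; case: ZBx].
apply: (le_trans fZ'); rewrite -(fineK Bfin) -EFinM lee_fin mulrAC ler_pdivrMr//.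
by rewrite ler_pM2l// /b lerDl.
Qed.

(** The Jacobian is the density of m, almost everywhere on a countable union of
    sets P i as in [jacobian_lt_density_null]. *)
Lemma jacobian_density_ae (P : nat -> set X) :
  (forall i, mu.-cara.-measurable (P i)) ->
  (forall i A, mu.-cara.-measurable A -> A `<=` P i -> m A <= nu (f @` (A `&` E))) ->
  mu [set x | (\bigcup_i P i) x /\ J x <> g x] = 0.
Proof.
move=> mP mnu; pose B n := ball (point : X) n.+1%:R.
pose pos_lt (p : rat * rat) : bool :=
  ((0 < ratr p.1 :> R) && (ratr p.1 < ratr p.2 :> R))%R.
pose F1 (i : nat * (rat * rat)) := if pos_lt i.2 then
  [set x | [/\ B i.1 x, g x < (ratr i.2.1)%:E & (ratr i.2.2)%:E < J x]]
  else set0.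
pose F2 (i : nat * nat * (rat * rat)) := if pos_lt i.2 then
  [set x | [/\ P i.1.2 x, B i.1.1 x, J x < (ratr i.2.1)%:E &
    (ratr i.2.2)%:E < g x]]
  else set0.
apply: (outer_measure_null_le
  (B := [set x | J x < 0] `|` (\bigcup_i F1 i `|` \bigcup_i F2 i))).
  move=> x [[i _ Pix] Jg]; have [J0|J0] := ltP (J x) 0; first by left.
  right; have [n _ Bx] : (\bigcup_n B n) x by rewrite bigcup_ball.
  have [Jltg|gJ|//] := ltgtP (J x) (g x).
    right; have [p [q [p0 pq Jp qg]]] := ereal_rat_between J0 Jltg.
    by exists (n, i, (p, q)) => //; rewrite /F2/pos_lt/= p0 pq.
  left; have [p [q [p0 pq Jp qg]]] := ereal_rat_between (g_ge0 x) gJ.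
  by exists (n, (p, q)) => //; rewrite /F1/pos_lt/= p0 pq.
apply/eqP; rewrite eq_le outer_measure_ge0 andbT.
apply: (le_trans (outer_measureU2 _ _ _)); rewrite jacobian_ge0_ae add0e.
apply: (le_trans (outer_measureU2 _ _ _)).
rewrite outer_measure_null_bigcup ?add0e; last first.
  move=> [n [p q]]; rewrite /F1/=; case: ifPn => [/andP[p0 pq]|_]; last first.
    exact: outer_measure0.
  by apply: (jacobian_gt_density_null (x0 := point) (r := n.+1%:R) (ltW p0) pq)
    => x [].
rewrite outer_measure_null_bigcup// => -[[n i] [p q]].
rewrite /F2/=; case: ifPn => [/andP[p0 pq]|_]; last exact: outer_measure0.
by apply: (jacobian_lt_density_null (x0 := point) (r := n.+1%:R) p0 pq
  _ (mP i) _ (mnu i)) => x [].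
Qed.

End density.
End differentiation.

(** * The area formula *)

(* The conclusion also states the measurability of both integrands, so that the
   library integrals are the integrals of measurable functions. *)
Theorem theorem2 (R : realType) (X : completeMetricType R) (Y : pMetricType R)
    (mu : {outer_measure set X -> \bar R})
    (nu : {outer_measure set Y -> \bar R})
    (V : set (X * set X)) (E : set X) (f : X -> Y)
    (A : set X) (Ei : nat -> set X) :
  separable_space X ->
  borel_regular mu ->
  finite_on_bounded mu ->
  borel_measure nu ->
  vitali_relation mu V ->
  closed E ->
  {within E, continuous f} ->
  finite_on_bounded (pullback_measure E f nu) ->
  abs_continuous (pullback_measure E f nu) mu ->
  A `<=` E ->
  mu.-cara.-measurable A ->
  trivIset setT Ei ->
  (forall i, mu.-cara.-measurable (Ei i)) ->
  mu (E `\` \bigcup_i Ei i) = 0 ->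
  (forall i, (1 <= i)%N -> {in Ei i `&` E &, injective f}) ->
  mu [set x | (Ei 0%N `&` E) x /\ vitali_jacobian E f nu mu V x <> 0] = 0 ->
  [/\ measurable_fun (A : set (caratheodory_type mu))
        (vitali_jacobian E f nu mu V : caratheodory_type mu -> \bar R),
      measurable_fun [set: caratheodory_type nu]
        (multiplicity f A : caratheodory_type nu -> \bar R) &
      \int[mu : set (caratheodory_type mu) -> \bar R]_(x in A)
         vitali_jacobian E f nu mu V x =
      \int[nu : set (caratheodory_type nu) -> \bar R]_y multiplicity f A y].
Proof.
move=> sX rmu fmu bnu vV cE cf fpb acpb AE mA tEi mEi E0 injf J0.
set J := vitali_jacobian E f nu mu V.
have bmu := proj1 rmu.
have mE : mu.-cara.-measurable E by apply: bmu; exact: borel_closed.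
have [m mE'] := multiplicity_measureP sX rmu fmu bnu cE cf acpb.
have mfin x r : m (ball x r) < +oo.
  rewrite mE'; apply: (@le_lt_trans _ _ (pullback_measure E f nu (ball x r))).
    by apply: multiplicity_measure_le_pullback => //; apply: bmu; exact: ball_borel.
  exact: finite_on_ball.
have m_ac (N : set X) : mu N = 0 -> m N = 0.
  by move=> N0; rewrite mE'; exact: multiplicity_measure_ac.
have nu0 (N : set X) : mu N = 0 -> nu (f @` (N `&` E)) = 0.
  by move=> N0; exact: (null_image acpb).
have nu_le_m (B : set X) : mu.-cara.-measurable B -> nu (f @` (B `&` E)) <= m B.
  by move=> mB; rewrite mE'; exact: image_le_multiplicity_measure.
have [|||||g [g0 mg gE]] := @sigma_finite_density _ (caratheodory_type mu) R
    (mu : {measure set (caratheodory_type mu) -> \bar R}) m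
    (fun n => ball (point : X) n.+1%:R).
- by move=> n; apply: bmu; exact: ball_borel.
- exact: bigcup_ball.
- by move=> n; exact: finite_on_ball.
- by move=> n; exact: mfin.
- by move=> N _; exact: m_ac.
(* On E_0 only the points where the Jacobian vanishes are retained. *)
pose P i := if i is 0%N then (Ei 0%N `&` E) `\` [set x | (Ei 0%N `&` E) x /\ J x <> 0]
            else Ei i `&` E.
have mP i : mu.-cara.-measurable (P i).
  case: i => [|i] /=; last exact: measurableI.
  by apply: measurableD; [exact: measurableI|exact: caratheodory_null].
have mnu i (B : set X) : mu.-cara.-measurable B -> B `<=` P i ->
    m B <= nu (f @` (B `&` E)).
  move=> mB BP; rewrite mE'; case: i BP => [|i] BP; last first.
    rewrite (multiplicity_measure_inj sX rmu fmu bnu cE cf acpb)// => x y.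
    rewrite !inE => -[/BP Bx _] [/BP By _]; apply: (injf i.+1) => //; rewrite inE //.
  have fB0 : nu (f @` (B `&` E)) = 0.
    apply: (jacobian_eq0_image_null rmu fmu vV nu0); first exact: subIsetr.
    by move=> x [/BP[EEx Jx] _]; apply: contrapT => Jx0; apply: Jx.
  by rewrite (multiplicity_measure_null sX rmu fmu bnu cE cf acpb)// fB0.
have Jg0 := jacobian_density_ae rmu fmu vV nu0 nu_le_m m_ac mfin g0 mg gE mP mnu.
have JgE0 : mu [set x | E x /\ J x <> g x] = 0.
  apply: (outer_measure_null_le (B := (E `\` \bigcup_i Ei i) `|`
    ([set x | (Ei 0%N `&` E) x /\ J x <> 0] `|`
     [set x | (\bigcup_i P i) x /\ J x <> g x]))).
    move=> x [Ex Jgx].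
    have [[i _ Eix]|nEx] := pselect ((\bigcup_i Ei i) x); last by left.
    right; case: i Eix => [|i] Eix; last by right; split => //; exists i.+1.
    have [Jx0|Jx] := pselect (J x = 0); last by left.
    by right; split => //; exists 0%N => //; split => // -[].
  apply/eqP; rewrite eq_le outer_measure_ge0 andbT.
  apply: (le_trans (outer_measureU2 _ _ _)); rewrite E0 add0e.
  by apply: (le_trans (outer_measureU2 _ _ _)); rewrite J0 Jg0 add0e.
have gJ : ae_eq (mu : set (caratheodory_type mu) -> \bar R) A g J.
  exists [set x | E x /\ J x <> g x]; split => //; first exact: caratheodory_null.
  move=> x /= /not_implyP[Ax gJx]; split; first exact: AE.
  by move=> Jgx; apply: gJx; rewrite Jgx.
have mJ : measurable_fun (A : set (caratheodory_type mu))
    (J : caratheodory_type mu -> \bar R).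
  apply: (ae_measurable_fun _ gJ); last exact: measurable_funTS.
  exact: measure_is_complete_caratheodory.
split => //; first exact: (measurable_multiplicity sX rmu fmu bnu cE cf acpb).
transitivity (\int[mu : set (caratheodory_type mu) -> \bar R]_(x in A) g x).
  by apply/esym; apply: ae_eq_integral => //; exact: measurable_funTS.
by rewrite -gE// mE' /multiplicity_measure setIidl.
Qed.
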